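(* The triple nodes of the Dynkin diagrams of types $D_4$, $D_5$, $E_6$, $E_7$ (corresponding respectively to the representations $\mathbb{C}^2\otimes\mathbb{C}^2\otimes\mathbb{C}^2$, $\mathbb{C}^2\otimes\mathbb{C}^2\otimes\mathbb{C}^3$, $\mathbb{C}^2\otimes\mathbb{C}^3\otimes\mathbb{C}^3$, $\mathbb{C}^2\otimes\mathbb{C}^3\otimes\mathbb{C}^4$) yield the non additive weakly stable triples $$(22,22,22),\quad (33,33,222),\quad (66,444,444),\quad (66,444,3333).$$ That is, each of these four triples is weakly stable and is not additive.
   Context: Kronecker coefficients: $g(\lambda,\mu,\nu)=\dim([\lambda]\otimes[\mu]\otimes[\nu])^{S_n}$ for partitions of $n$, with $[\lambda]$ the irreducible complex $S_n$-representation indexed by $\lambda$. A triple $(\alpha,\beta,\gamma)$ is weakly stable if $g(k\alpha,k\beta,k\gamma)=1$ for all $k\ge1$. Notation such as $444$ means the partition $(4,4,4)$. A standard tableau $T$ of rectangular shape $a\times b$ is additive if there exist sequences $x_1<\cdots<x_a$ and $y_1<\cdots<y_b$ such that $T(i,j)<T(k,l)\Leftrightarrow x_i+y_j<x_k+y_l$. A triple is additive if, up to permutation, it is of the form $(\lambda,a_T(\lambda),b_T(\lambda))$ for an additive standard tableau $T$ of some shape $a\times b$ and a partition $\lambda$ of length at most $ab$, where $a_T(\lambda)_i=\sum_{j=1}^b\lambda_{T(i,j)}$ and $b_T(\lambda)_j=\sum_{i=1}^a\lambda_{T(i,j)}$. *)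

(* Defs.v *)
From HB Require Import structures.
From mathcomp Require Import all_boot all_order all_algebra all_fingroup.
From mathcomp Require Import all_character.
From mathcomp Require Import reals complex.

Set Implicit Arguments.
Unset Strict Implicit.
Unset Printing Implicit Defensive.

Import Order.TTheory GRing.Theory Num.Theory.
Local Open Scope nat_scope.

(* A partition is its list of nonzero parts, without trailing zeros: [444] is
   [:: 4; 4; 4], and the i-th part, extended by 0, is [nth 0 la i] (from 0). *)
Definition is_part (la : seq nat) : bool := sorted geq la && (0 \notin la).

Definition part_of (n : nat) (la : seq nat) : bool :=
  is_part la && (sumn la == n).

Definition scale_part (k : nat) (la : seq nat) : seq nat :=
  [seq k * p | p <- la].

(* The diagram of [la] is filled with 0, 1, ..., n.-1 row after row, so that
   [i] lies in row [reshape_index la i] and column [reshape_offset la i]. *)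
Definition row_stab (n : nat) (la : seq nat) : {set 'S_n} :=
  [set s : 'S_n | [forall i, reshape_index la (s i) == reshape_index la i]].

Definition col_stab (n : nat) (la : seq nat) : {set 'S_n} :=
  [set s : 'S_n | [forall i, reshape_offset la (s i) == reshape_offset la i]].

Section Specht.

Variables (F : fieldType) (n : nat) (la : seq nat).

Local Notation G := [set: 'S_n]%G.
Local Notation aG := (regular_repr F G).

Local Open Scope ring_scope.

(* An element of the group algebra F[S_n] is represented by its right
   multiplication matrix; [gring_row] returns its coordinates on the basis
   S_n. *)
Definition young_symmetrizer : 'M[F]_#|G| :=
  (\sum_(p in row_stab n la) aG p)
    *m (\sum_(q in col_stab n la) (-1) ^+ q *: aG q).

(* The right ideal of F[S_n] generated by the Young symmetrizer of [la], for
   [la] a partition of [n]. *)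
Definition specht : representation F G :=
  Representation
    (submod_repr (cyclic_mx_module aG (gring_row young_symmetrizer))).

End Specht.

(* The dimension of the S_n-invariants of the tensor product of the three
   representations, for partitions [la], [mu], [nu] of [n]. *)
Definition kronecker (F : fieldType) (n : nat) (la mu nu : seq nat) : nat :=
  \rank (rfix_mx
    (prod_repr (prod_repr (specht F n la) (specht F n mu)) (specht F n nu))
    [set: 'S_n]).

Definition weakly_stable (R : realType) (n : nat) (al be ga : seq nat) : Prop :=
  [/\ part_of n al, part_of n be, part_of n ga
    & forall k : nat, 0 < k ->
        kronecker (complex R) (k * n)
          (scale_part k al) (scale_part k be) (scale_part k ga) = 1].

(* Rows, columns and entries are all numbered from 0. *)
Definition standard_tableau (a b : nat) (T : 'M['I_(a * b)]_(a, b)) : Prop :=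
  [/\ injective (fun ij : 'I_a * 'I_b => T ij.1 ij.2),
      forall (i : 'I_a) (j l : 'I_b), j < l -> T i j < T i l
    & forall (i k : 'I_a) (j : 'I_b), i < k -> T i j < T k j].

Definition additive_tableau (R : realType) (a b : nat)
    (T : 'M['I_(a * b)]_(a, b)) : Prop :=
  exists (x : 'I_a -> R) (y : 'I_b -> R),
    [/\ forall i k : 'I_a, i < k -> (x i < x k)%R,
        forall j l : 'I_b, j < l -> (y j < y l)%R
      & forall (i k : 'I_a) (j l : 'I_b),
          T i j < T k l <-> (x i + y j < x k + y l)%R].

(* The filters remove the zero parts, which are all trailing when [T] is
   standard and [la] is a partition. *)
Definition row_marginal (a b : nat) (T : 'M['I_(a * b)]_(a, b))
    (la : seq nat) : seq nat :=
  [seq m <- [seq \sum_(j < b) nth 0 la (T i j) | i <- enum 'I_a] | 0 < m].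

Definition col_marginal (a b : nat) (T : 'M['I_(a * b)]_(a, b))
    (la : seq nat) : seq nat :=
  [seq m <- [seq \sum_(i < a) nth 0 la (T i j) | j <- enum 'I_b] | 0 < m].

Definition additive_triple (R : realType) (al be ga : seq nat) : Prop :=
  exists (a b : nat) (T : 'M['I_(a * b)]_(a, b)) (la : seq nat),
    [/\ standard_tableau T, additive_tableau R T, is_part la,
        size la <= a * b
      & perm_eq [:: al; be; ga]
          [:: la; row_marginal T la; col_marginal T la]].

(* Main.v *)
Require Import Defs.
From mathcomp Require Import all_boot reals.
From mathcomp Require Import all_algebra all_fingroup all_character.
From mathcomp Require Import complex ring.

(** The Kronecker coefficient of three rectangular partitions with [a1], [a2]
    and [a3] rows is the dimension of the space of polynomials of degree [n] on
    [C^a1 (x) C^a2 (x) C^a3] that are invariant under the product of the three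
    special linear groups.  In the four cases the product of the general linear
    groups has an open orbit in this tensor product.  A semi-invariant is determined
    by its value at one point of an open orbit, so that all coefficients
    [g(k al, k be, k ga)] are at most 1.  They are at least 1 because there is an
    invariant of degree 4, 6, 12, 12 respectively, and its powers are nonzero.

    The proof follows this idea with tensors in the place of polynomials.  The
    group algebra acts on the word that writes in each cell of the
    diagram its row number; this embeds the Specht module of a rectangle
    into a tensor power, as the span of the products of determinants over
    the columns of all arrangements of the positions in a rectangle
    ([specht_coordinates]).  An invariant vector of the triple product then
    becomes a symmetric multilinear form which is semi-invariant under the three
    Lie algebras.  Neither orbits nor density are needed: if the tangent
    space of the orbit at [x0] is everything, a semi-invariant symmetric
    form that vanishes at [x0] is zero, by an induction that frees its
    arguments one by one ([tangent_vanish]).  Surjectivity on the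
    tangent space is a linear system, solved explicitly for each of the four
    tensors.

    For the lower bound, three arrangements of the positions define an invariant;
    its value at a tensor [x0] with few nonzero entries is a sum over words,
    computed by a search that prunes words with a repetition in a
    column ([detform_search]).  Repeating the arrangements in [k] blocks raises
    this value to the power [k], which settles all multiples at once
    ([kronecker_multiples]).

    Additivity fails for arithmetical reasons.  In an additive triple, the parts
    of the two marginals are sums of parts of the third partition, so any common
    divisor of the parts of the latter divides all parts; this excludes every
    choice of the third partition for three of the triples.  For (22, 22, 22)
    the two least cells of a standard tableau share a row or a column, which
    produces a marginal part at least 4. *)

Set Implicit Arguments.
Unset Strict Implicit.
Unset Printing Implicit Defensive.

Import GRing.Theory.
Local Open Scope ring_scope.

(** * Bilinearity of the Kronecker product of matrices *)

Section TensorLinear.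

Variable F : fieldType.

Lemma tprod_linearl m1 n1 m2 n2 k (A1 A2 : 'M[F]_(m1, n1)) (B : 'M[F]_(m2, n2)) :
  tprod (k *: A1 + A2) B = k *: tprod A1 B + tprod A2 B.
Proof.
elim: m1 A1 A2 => [|m1 IH] A1 A2 /=; first by rewrite scaler0 addr0.
rewrite !linearD !linearZ /= IH -!trowbE linearD linearZ /=.
by rewrite scale_col_mx add_col_mx.
Qed.

Lemma tprod_linearr m1 n1 m2 n2 k (A : 'M[F]_(m1, n1)) (B1 B2 : 'M[F]_(m2, n2)) :
  tprod A (k *: B1 + B2) = k *: tprod A B1 + tprod A B2.
Proof.
elim: m1 A => [|m1 IH] A /=; first by rewrite scaler0 addr0.
by rewrite IH linearD linearZ /= scale_col_mx add_col_mx.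
Qed.

Lemma tprod0l m1 n1 m2 n2 (B : 'M[F]_(m2, n2)) :
  tprod (0 : 'M_(m1, n1)) B = 0.
Proof.
have := tprod_linearl (- 1) (0 : 'M_(m1, n1)) 0 B.
by rewrite scaler0 addr0 scaleN1r addNr.
Qed.

Lemma tprod0r m1 n1 m2 n2 (A : 'M[F]_(m1, n1)) :
  tprod A (0 : 'M_(m2, n2)) = 0.
Proof.
have := tprod_linearr (- 1) A (0 : 'M_(m2, n2)) 0.
by rewrite scaler0 addr0 scaleN1r addNr.
Qed.

Lemma tprodZl m1 n1 m2 n2 k (A : 'M[F]_(m1, n1)) (B : 'M[F]_(m2, n2)) :
  tprod (k *: A) B = k *: tprod A B.
Proof. by have := tprod_linearl k A 0 B; rewrite tprod0l !addr0. Qed.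

Lemma tprodZr m1 n1 m2 n2 k (A : 'M[F]_(m1, n1)) (B : 'M[F]_(m2, n2)) :
  tprod A (k *: B) = k *: tprod A B.
Proof. by have := tprod_linearr k A B 0; rewrite tprod0r !addr0. Qed.

Lemma tprod_suml (I : finType) m1 n1 m2 n2 (A : I -> 'M[F]_(m1, n1))
    (B : 'M[F]_(m2, n2)) :
  tprod (\sum_i A i) B = \sum_i tprod (A i) B.
Proof.
apply: (big_morph (fun A => tprod A B)) => [A1 A2|]; last exact: tprod0l.
by rewrite -[A1]scale1r tprod_linearl !scale1r.
Qed.

Lemma tprod_sumr (I : finType) m1 n1 m2 n2 (A : 'M[F]_(m1, n1))
    (B : I -> 'M[F]_(m2, n2)) :
  tprod A (\sum_i B i) = \sum_i tprod A (B i).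
Proof.
apply: (big_morph (fun B => tprod A B)) => [B1 B2|]; last exact: tprod0r.
by rewrite -[B1]scale1r tprod_linearr !scale1r.
Qed.

Lemma tprod3_sum (I1 I2 I3 : finType) m1 n1 m2 n2 m3 n3
    (A1 : I1 -> 'M[F]_(m1, n1)) (A2 : I2 -> 'M[F]_(m2, n2))
    (A3 : I3 -> 'M[F]_(m3, n3)) :
  tprod (tprod (\sum_i A1 i) (\sum_i A2 i)) (\sum_i A3 i)
    = \sum_i \sum_j \sum_k tprod (tprod (A1 i) (A2 j)) (A3 k).
Proof.
rewrite [tprod (\sum_i A1 i) _]tprod_suml tprod_suml; apply: eq_bigr => i _.
rewrite [tprod (A1 i) _]tprod_sumr tprod_suml; apply: eq_bigr => j _.
exact: tprod_sumr.
Qed.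

Lemma tprod11 (A B : 'M[F]_1) : tprod A B 0 0 = A 0 0 * B 0 0.
Proof.
rewrite /= mxE; case: splitP => [i _|[] //].
rewrite mxE; case: splitP => [j _|[] //].
by rewrite !mxE !ord1.
Qed.

End TensorLinear.

(** * Words, multilinear forms and the tangent criterion *)

Section Words.

Variables (n : nat) (J : finType).

(** Words of length [n] over [J] index the coordinates of the [n]-th tensor
    power of the space with basis [J]; [upd] and [wperm] are the shadows on
    coordinates of the Lie algebra and of the symmetric group actions. *)
Definition upd (w : {ffun 'I_n -> J}) (i : 'I_n) (q : J) : {ffun 'I_n -> J} :=
  [ffun j => if j == i then q else w j].

Definition wperm (w : {ffun 'I_n -> J}) (s : 'S_n) : {ffun 'I_n -> J} :=
  [ffun i => w (s i)].

Lemma upd_perm w (s : 'S_n) i q : wperm (upd w (s i) q) s = upd (wperm w s) i q.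
Proof. by apply/ffunP=> j; rewrite !ffunE (inj_eq perm_inj). Qed.

Lemma wpermM w s t : wperm (wperm w s) t = wperm w (t * s)%g.
Proof. by apply/ffunP=> i; rewrite !ffunE permM. Qed.

Lemma wperm1 w : wperm w 1%g = w.
Proof. by apply/ffunP=> i; rewrite !ffunE perm1. Qed.

Lemma wperm_bij s : bijective (wperm^~ s).
Proof.
by exists (wperm^~ (s^-1)%g) => w; rewrite wpermM (mulVg, mulgV) wperm1.
Qed.

End Words.

Section TangentInduction.

Variables (F : fieldType) (n : nat) (J : finType).
Hypothesis char0 : forall m, m.+1%:R != 0 :> F.

Implicit Types (f : {ffun 'I_n -> J} -> F) (v : 'I_n -> J -> F).

(** The multilinear form with coordinates [f]; when [f] is symmetric, its
    restriction to the diagonal is a homogeneous polynomial of degree [n]. *)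
Definition mform f v : F := \sum_(w : {ffun 'I_n -> J}) f w * \prod_i v i (w i).

Definition lieact (X : J -> J -> F) (x : J -> F) (q : J) : F :=
  \sum_p x p * X p q.

(** [f] is a semi-invariant of the one-parameter group generated by [X], in
    its infinitesimal form; the scalar [c] is the derivative of the
    character. *)
Definition lie_invariant f (X : J -> J -> F) : Prop :=
  exists c, forall w : {ffun 'I_n -> J},
    \sum_i \sum_q X (w i) q * f (upd w i q) = c * f w.

Definition setv v (i : 'I_n) (x : J -> F) : 'I_n -> J -> F :=
  fun j => if j == i then x else v j.

Lemma eq_mform f v v' : (forall i q, v i q = v' i q) -> mform f v = mform f v'.
Proof. by move=> ev; apply: eq_bigr => w _; congr (_ * _); apply: eq_bigr. Qed.

Lemma mform_basis f (w : {ffun 'I_n -> J}) : mform f (fun i q => (w i == q)%:R) = f w.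
Proof.
rewrite /mform (bigD1 w) //= [X in _ * X]big1 ?mulr1 => [|i _].
  rewrite big1 ?addr0 // => w' neq_w'.
  have [i neq_i] : exists i, w i != w' i.
    apply/existsP; apply: contraR neq_w'; rewrite negb_exists => /forallP eq_w.
    by apply/eqP/ffunP=> i; apply/esym/eqP; have := eq_w i; rewrite negbK.
  by rewrite (bigD1 i) //= (negPf neq_i) mul0r mulr0.
by rewrite eqxx.
Qed.

(** Moving [X] from the vectors to the coordinates amounts to exchanging the
    letter summed over in [v i] with the letter of the word at [i], which is
    an involution on pairs of a word and a letter. *)
Lemma mform_lieact f X v i :
  mform f (setv v i (lieact X (v i)))
    = \sum_(w : {ffun 'I_n -> J}) (\sum_q X (w i) q * f (upd w i q)) * \prod_j v j (w j).
Proof.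
pose rest (w : {ffun 'I_n -> J}) := \prod_(j | j != i) v j (w j).
transitivity (\sum_(w : {ffun 'I_n -> J}) \sum_p f w * (v i p * X p (w i) * rest w)).
  apply: eq_bigr => w _; rewrite (bigD1 i) //= /setv eqxx /lieact.
  rewrite mulr_suml mulr_sumr; apply: eq_bigr => p _.
  by congr (_ * (_ * _)); apply: eq_bigr => j /negPf->.
transitivity (\sum_(w : {ffun 'I_n -> J})
  \sum_q X (w i) q * f (upd w i q) * (v i (w i) * rest w)).
  rewrite !pair_big /=.
  have swK : involutive (fun u : {ffun 'I_n -> J} * J =>
                           (upd u.1 i u.2, u.1 i)).
    move=> [w q] /=; congr (_, _); last by rewrite ffunE eqxx.
    by apply/ffunP=> j; rewrite !ffunE; case: eqP => [->|].
  rewrite (reindex_inj (inv_inj swK)) /=; apply: eq_bigr => -[w q] _ /=.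
  rewrite !ffunE eqxx (_ : rest (upd w i q) = rest w); first by ring.
  by apply: eq_bigr => j /negPf neq_j; rewrite ffunE neq_j.
apply: eq_bigr => w _; rewrite mulr_suml; apply: eq_bigr => q _.
by rewrite [in RHS](bigD1 i).
Qed.

Lemma mform_lie_sum f X c v :
    (forall w : {ffun 'I_n -> J}, \sum_i \sum_q X (w i) q * f (upd w i q) = c * f w) ->
  \sum_i mform f (setv v i (lieact X (v i))) = c * mform f v.
Proof.
move=> lieX; under eq_bigr do rewrite mform_lieact.
rewrite exchange_big /= mulr_sumr; apply: eq_bigr => w _.
by rewrite -mulr_suml lieX mulrA.
Qed.

Lemma mform_perm f v (s : 'S_n) :
  (forall w, f (wperm w s) = f w) -> mform f (fun i => v (s i)) = mform f v.
Proof.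
move=> fs; rewrite /mform (reindex (@wperm n J ^~ s)) /=; last first.
  exact/onW_bij/wperm_bij.
apply: eq_bigr => w _; rewrite fs; congr (_ * _).
rewrite [RHS](reindex_inj (@perm_inj _ s)) /=.
by apply: eq_bigr => i _; rewrite ffunE.
Qed.

(** A symmetric semi-invariant form that vanishes at [x0] vanishes to all
    orders there once the tangent space of the orbit of [x0] is everything.
    The induction is on the number of arguments that differ from [x0].  To
    free one more argument [v s], write it as [X x0] and apply the invariance
    under [X] to the arguments in which [v s] is replaced by [x0]: the terms
    where [X] hits another free argument vanish by induction, and those where
    it hits a copy of [x0] are all equal to the desired value by symmetry. *)
Lemma tangent_vanish f (x0 : J -> F) :
    (forall w (s : 'S_n), f (wperm w s) = f w) ->
    (forall y, exists2 X, lie_invariant f X & lieact X x0 =1 y) ->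
  mform f (fun=> x0) = 0 -> forall w, f w = 0.
Proof.
move=> fsym span fx0.
suff vanish m : forall (A : {set 'I_n}) v, (#|A| <= m)%N ->
    (forall i, i \notin A -> v i = x0) -> mform f v = 0.
  move=> w; rewrite -(mform_basis f w).
  by apply: (vanish #|[set: 'I_n]| setT) => // i; rewrite inE.
elim: m => [|m IHm] A v.
  rewrite leqn0 cards_eq0 => /eqP-> vx0.
  by rewrite -fx0; apply: eq_mform => i q; rewrite vx0 ?inE.
have [-> _ vx0|[s As] leAm vx0] := set_0Vmem A.
  by apply: (IHm set0) vx0; rewrite cards0.
have leAm' : (#|A :\ s| <= m)%N by rewrite (cardsD1 s) As in leAm.
have [X [c lieX] Xx0] := span (v s).
pose v' := setv v s x0.
have v'x0 i : i \notin A :\ s -> v' i = x0.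
  by rewrite !inE /v' /setv negb_and negbK; case: eqP => //= _ /vx0.
(* The sum over the positions splits into the free ones, which contribute
   nothing, and the others, which contribute the same value. *)
have := mform_lie_sum v' lieX; rewrite (IHm _ _ leAm' v'x0) mulr0.
rewrite (bigID (mem (A :\ s))) /= big1 ?add0r => [|i Ai]; last first.
  apply: (IHm (A :\ s)) => // j Aj; rewrite /setv.
  by case: eqP => [eji|_]; [rewrite eji Ai in Aj | rewrite v'x0].
have allv i : i \notin A :\ s ->
    mform f (setv v' i (lieact X (v' i))) = mform f v.
  move=> nAi; rewrite (v'x0 i) // -(@mform_perm f v (tperm i s)) //.
  apply: eq_mform => j q; rewrite /setv /v' /setv.
  case: tpermP => [->|->|/eqP/negPf-> /eqP/negPf-> //]; rewrite ?eqxx //.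
  rewrite eq_sym; case: eqP => [->|/eqP neq_is] //.
  by rewrite vx0 //; rewrite !inE neq_is in nAi.
rewrite (eq_bigr _ allv) sumr_const -mulr_natl => /eqP.
rewrite mulf_eq0 => /orP[|/eqP//].
have s_in : s \in [predC A :\ s] by rewrite !inE eqxx.
have: (0 < #|[predC A :\ s]|)%N by apply/card_gt0P; exists s.
rewrite (@eq_card _ _ [predC A :\ s]) //.
by case: #|_| => // k _ /idPn[]; apply: char0.
Qed.

End TangentInduction.

(** * Column determinants of words *)

Section DetWord.

Variables (F : fieldType) (n a : nat) (C : finType).

Definition lettermx (w : 'I_a -> 'I_a) : 'M[F]_a :=
  \matrix_(r, s) (w r == s)%:R.

(** The coordinates of the tensor obtained by placing one determinant tensor
    on each column of a rectangular arrangement [pos] of the positions: the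
    basic [SL_a]-invariant tensor. *)
Definition detword (P : Type) (pos : C -> 'I_a -> P) (w : P -> 'I_a) : F :=
  \prod_j \det (lettermx (w \o pos j)).

Lemma eq_lettermx w w' : w =1 w' -> lettermx w = lettermx w'.
Proof. by move=> eww; apply/matrixP=> r s; rewrite !mxE eww. Qed.

Lemma eq_detword (P : Type) (pos : C -> 'I_a -> P) w w' :
  w =1 w' -> detword pos w = detword pos w'.
Proof.
by move=> eww; apply: eq_bigr => j _; congr (\det _); apply: eq_lettermx => r /=.
Qed.

Lemma lettermx_swap w r r' : r != r' ->
  \det (lettermx (w \o tperm r r')) = - \det (lettermx w).
Proof.
move=> neq_rr; have -> : lettermx (w \o tperm r r') = xrow r r' (lettermx w).
  by apply/matrixP=> i j; rewrite !mxE.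
by rewrite xrowE det_mulmx det_perm odd_tperm neq_rr expr1 mulN1r.
Qed.

(** The derivative of the character [det] is the trace. *)
Lemma det_lie (w : 'I_a -> 'I_a) (X : 'M[F]_a) :
  \sum_r \sum_s X (w r) s
      * \det (lettermx (fun i => if i == r then s else w i))
    = \tr X * \det (lettermx w).
Proof.
set M := lettermx w.
have XwE r s : X (w r) s = (M *m X) r s.
  rewrite mxE (bigD1 (w r)) //= mxE eqxx mul1r big1 ?addr0 // => p neq_p.
  by rewrite mxE eq_sym (negPf neq_p) mul0r.
(* Replacing row [r] by a basis vector selects a cofactor, so that the left
   side becomes the trace of [M X adj(M)]. *)
have cofE r s :
    \det (lettermx (fun i => if i == r then s else w i)) = (\adj M) s r.
  rewrite (expand_det_row _ r) (bigD1 s) //= !mxE !eqxx mul1r big1 ?addr0; last first.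
    by move=> p neq_p; rewrite mxE eqxx eq_sym (negPf neq_p) mul0r.
  congr (_ * \det _); apply/matrixP=> i j; rewrite !mxE.
  by rewrite [_ == r]eq_sym (negPf (neq_lift _ _)).
transitivity (\tr (M *m X *m \adj M)).
  apply: eq_bigr => r _; rewrite mxE; apply: eq_bigr => s _.
  by rewrite XwE cofE.
by rewrite -mulmxA mxtrace_mulC -mulmxA mul_adj_mx mul_mx_scalar linearZ mulrC.
Qed.

Section Positions.

Variable pos : C -> 'I_a -> 'I_n.
Hypothesis pos_bij : bijective (fun p : C * 'I_a => pos p.1 p.2).

Lemma pos_eq j r j' r' : (pos j r == pos j' r') = (j == j') && (r == r').
Proof. exact: (inj_eq (bij_inj pos_bij) (j, r) (j', r')). Qed.

Lemma pos_surj i : exists j r, i = pos j r.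
Proof.
by case: pos_bij => q _ qK; exists (q i).1, (q i).2; rewrite [pos _ _]qK.
Qed.

Lemma detword_lie (w : {ffun 'I_n -> 'I_a}) (X : 'M[F]_a) :
  \sum_i \sum_s X (w i) s * detword pos (upd w i s)
    = #|C|%:R * \tr X * detword pos w.
Proof.
rewrite (reindex _ (onW_bij _ pos_bij)) /=.
rewrite -(pair_bigA _ (fun j r => \sum_s X (w (pos j r)) s
                                  * detword pos (upd w (pos j r) s))) /=.
transitivity (\sum_(j : C) \tr X * detword pos w); last first.
  by rewrite sumr_const -mulrA mulr_natl.
apply: eq_bigr => j _; rewrite [in RHS]/detword (bigD1 j) //= mulrA -det_lie.
rewrite mulr_suml; apply: eq_bigr => r _; rewrite mulr_suml.
apply: eq_bigr => s _; rewrite -mulrA; congr (_ * _).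
rewrite /detword (bigD1 j) //=; congr (\det _ * _).
  by apply: eq_lettermx => i /=; rewrite ffunE pos_eq eqxx.
apply: eq_bigr => j' neq_j; congr (\det _).
by apply: eq_lettermx => i /=; rewrite ffunE pos_eq (negPf neq_j).
Qed.

Lemma detword_swap (w : {ffun 'I_n -> 'I_a}) j r r' : r != r' ->
  detword pos (wperm w (tperm (pos j r) (pos j r'))) = - detword pos w.
Proof.
move=> neq_rr; rewrite /detword (bigD1 j) //= [in RHS](bigD1 j) //= -mulNr.
rewrite -(lettermx_swap _ neq_rr); congr (\det _ * _).
  apply: eq_lettermx => i /=; rewrite ffunE; congr (w _).
  have inj_j : injective (pos j).
    by move=> x y /eqP; rewrite pos_eq eqxx => /eqP.
  by rewrite [RHS](inj_tperm _ _ _ inj_j).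
apply: eq_bigr => j' neq_j; congr (\det _).
by apply: eq_lettermx => i /=; rewrite ffunE tpermD // pos_eq eq_sym (negPf neq_j).
Qed.

End Positions.

End DetWord.

Section ColumnAlternating.

Variables (F : fieldType) (n a : nat) (C : finType).
Hypothesis char0 : forall m, m.+1%:R != 0 :> F.
Variables (pos : C -> 'I_a -> 'I_n) (row : {ffun 'I_n -> 'I_a}).
Hypothesis pos_bij : bijective (fun p : C * 'I_a => pos p.1 p.2).
Hypothesis row_pos : forall j r, row (pos j r) = r.

Definition column_alternating (f : {ffun 'I_n -> 'I_a} -> F) : Prop :=
  forall w j r r', r != r' ->
    f (wperm w (tperm (pos j r) (pos j r'))) = - f w.

(** A word that is injective on each column can be sorted into [row] by
    transpositions inside columns, each of which puts one more letter in its
    place; a word with a repetition in a column is fixed by a transposition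
    that changes the sign.  This spares any computation of the sign of a
    column permutation as a product of signs. *)
Lemma alternating_unique f g :
    column_alternating f -> column_alternating g -> f row = g row ->
  f =1 g.
Proof.
move=> altf altg fg_row w.
have [N] := ubnP #|[set i | w i != row i]|; elim: N => // N IHN in w *.
have vanish h j r r' : column_alternating h -> r != r' ->
    w (pos j r) = w (pos j r') -> h w = 0.
  move=> alth neq_rr eq_w; have := alth w j r r' neq_rr.
  rewrite (_ : wperm w _ = w); last first.
    by apply/ffunP=> i; rewrite ffunE; case: tpermP => [->|->|].
  move/eqP; rewrite -addr_eq0 -mulr2n -mulr_natl mulf_eq0.
  by rewrite (negPf (char0 1)) => /eqP.
move=> ltN; have [eq_w|neq_w] := eqVneq w row; first by rewrite eq_w.
have [i neq_i] : exists i, w i != row i.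
  apply/existsP; apply: contraR neq_w; rewrite negb_exists => /forallP eq_w.
  by apply/eqP/ffunP=> i; apply/eqP; have := eq_w i; rewrite negbK.
have [j [r def_i]] := pos_surj pos_bij i; rewrite {i}def_i row_pos in neq_i.
have [/injectiveP inj_w|] := boolP (injectiveb (fun s => w (pos j s))); last first.
  case/injectivePn=> x [y neq_xy eq_w].
  by rewrite (vanish f j x y) ?(vanish g j x y).
have [r' def_r'] : exists r', w (pos j r') = r.
  by have [q _ qK] := injF_bij inj_w; exists (q r).
have neq_rr : r != r' by apply: contraNneq neq_i => {1}->; rewrite def_r'.
apply/oppr_inj; rewrite -(altf w j r r') // -(altg w j r r') //.
apply: IHN; move: ltN; rewrite ltnS; apply: leq_trans; apply: proper_card.
apply/properP; split; last first.
  exists (pos j r); first by rewrite inE row_pos.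
  by rewrite inE ffunE tpermL def_r' row_pos eqxx.
apply/subsetP=> i; rewrite !inE ffunE.
case: tpermP => [->|->|//]; first by rewrite def_r' row_pos eqxx.
by rewrite def_r' !row_pos.
Qed.

End ColumnAlternating.

(** * Specht modules of rectangular shape *)

Section YoungSymmetrizer.

Variables (F : fieldType) (n a : nat) (C : finType) (la : seq nat).
Hypothesis char0 : forall m, m.+1%:R != 0 :> F.
Variables (pos : C -> 'I_a -> 'I_n) (row : {ffun 'I_n -> 'I_a}).
Hypothesis pos_bij : bijective (fun p : C * 'I_a => pos p.1 p.2).
Hypothesis row_pos : forall j r, row (pos j r) = r.
Hypothesis row_la : forall i, row i = reshape_index la i :> nat.
Hypothesis col_la : forall j j' r r',
  (reshape_offset la (pos j r) == reshape_offset la (pos j' r')) = (j == j').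

Local Notation G := [set: 'S_n]%G.
Local Notation aG := (regular_repr F G).
Local Notation word := {ffun 'I_n -> 'I_a}.
Local Notation U := (cyclic_mx aG (gring_row (young_symmetrizer F n la))).

(** The [w]-th coordinate of the tensor [row . u], for [u] in the group algebra:
    letting the group algebra act on the word [row], which writes in each
    cell its row number, embeds the Specht module into tensors. *)
Definition ev (w : word) : 'cV[F]_#|G| :=
  \col_k (wperm w (enum_val k) == row)%:R.

Lemma regular_ev g w : aG g *m ev w = ev (wperm w g).
Proof.
apply/colP=> k; rewrite mxE (bigD1 (gring_index G (enum_val k * g)%g)) //=.
rewrite big1 ?addr0 => [|l neq_l]; last by rewrite !mxE (negPf neq_l) mul0r.
by rewrite !mxE !eqxx mul1r gring_indexK ?inE // wpermM.
Qed.

Lemma gring_row_ev A w : (gring_row A *m ev w) 0 0 = (A *m ev w) (gring_index G 1) 0.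
Proof. by rewrite -row_mul mxE. Qed.

Lemma ev_gring1 w : ev w (gring_index G 1) 0 = (w == row)%:R.
Proof. by rewrite mxE gring_indexK ?group1 // wperm1. Qed.

Lemma row_stabP s : (s \in row_stab n la) = (wperm row s == row).
Proof.
rewrite inE; apply/forallP/eqP => [rs|rs i].
  by apply/ffunP=> i; rewrite ffunE; apply/val_inj; rewrite /= !row_la; apply/eqP.
by rewrite -!row_la; move/ffunP/(_ i): rs; rewrite ffunE => ->.
Qed.

Lemma row_stab_wperm p w : p \in row_stab n la ->
  (wperm w p == row) = (w == row).
Proof.
rewrite row_stabP => /eqP rp; rewrite -{1}rp.
exact: (inj_eq (bij_inj (@wperm_bij n 'I_a p))).
Qed.

Lemma card_row_stab_neq0 : #|row_stab n la|%:R != 0 :> F.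
Proof.
have: (0 < #|row_stab n la|)%N.
  by apply/card_gt0P; exists 1%g; rewrite row_stabP wperm1.
by case: #|_|.
Qed.

Definition colsum (w : word) : F :=
  \sum_(q in col_stab n la) (-1) ^+ q * (wperm w q == row)%:R.

(** Row permutations fix [row], hence only multiply the result by their
    number; what remains of the Young symmetrizer is the signed sum over
    column permutations. *)
Lemma young_ev w :
  (gring_row (young_symmetrizer F n la) *m ev w) 0 0
    = #|row_stab n la|%:R * colsum w.
Proof.
rewrite gring_row_ev /young_symmetrizer -mulmxA mulmx_suml summxE.
rewrite mulr_natl -sumr_const; apply: eq_bigr => p Rp.
rewrite mulmx_suml mulmx_sumr summxE; apply: eq_bigr => q _.
rewrite -scalemxAl -scalemxAr mxE; congr (_ * _).
by rewrite !regular_ev ev_gring1 (row_stab_wperm _ Rp).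
Qed.

Lemma col_stabM s t :
  s \in col_stab n la -> (t * s \in col_stab n la)%g = (t \in col_stab n la).
Proof.
rewrite !inE => /forallP cs; apply: eq_forallb => i.
by rewrite permM (eqP (cs _)).
Qed.

Lemma colsum_alternating : column_alternating pos colsum.
Proof.
move=> w j r r' neq_rr; set t := tperm _ _.
have neq_pos : pos j r != pos j r'.
  by rewrite pos_eq // eqxx.
have Ct : t \in col_stab n la.
  rewrite inE; apply/forallP=> i; rewrite /t; case: tpermP => [->|->|//];
  by rewrite col_la.
rewrite /colsum (reindex_inj (mulIg t)) /= -sumrN.
apply: eq_big => q; first exact: col_stabM.
move=> _; rewrite odd_permM odd_tperm neq_pos signr_addb expr1 mulrN1 mulNr.
by rewrite wpermM -mulgA tperm2 mulg1.
Qed.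

Lemma colsum_row : colsum row = 1.
Proof.
have C1 : 1%g \in col_stab n la by rewrite inE; apply/forallP=> i; rewrite perm1.
rewrite /colsum (bigD1 1%g) //= odd_perm1 wperm1 eqxx mulr1 big1 ?addr0 //.
move=> q /andP[Cq neq_q]; case: eqP => [rq|]; last by rewrite mulr0.
case/negP: neq_q; apply/eqP/permP=> i; rewrite perm1.
have [j [r def_i]] := pos_surj pos_bij i.
have [j' [r' def_qi]] := pos_surj pos_bij (q i).
have row_qi : row (q i) = row i by move/ffunP/(_ i): rq; rewrite ffunE.
move: Cq; rewrite inE => /forallP/(_ i).
rewrite def_qi def_i col_la => /eqP->.
by rewrite -(row_pos j' r') -def_qi row_qi def_i row_pos.
Qed.

Lemma detword_row : detword F pos row = 1.
Proof.
apply: big1 => j _; rewrite (_ : lettermx F _ = 1%:M) ?det1 //.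
by apply/matrixP=> r s; rewrite !mxE /= row_pos.
Qed.

Lemma detword_alternating : column_alternating pos (detword F pos).
Proof. by move=> w j r r'; apply: detword_swap. Qed.

(** The Young symmetrizer sends [row] to a multiple of the product of the
    determinants over the columns; the shape has to be a rectangle for every
    column to carry a full determinant. *)
Lemma colsumE w : colsum w = detword F pos w.
Proof.
apply: (alternating_unique char0 pos_bij row_pos colsum_alternating
          detword_alternating).
by rewrite colsum_row detword_row.
Qed.

Lemma submod_ev (u : 'rV[F]_#|G|) : (u <= U)%MS ->
  exists b : 'S_n -> F, forall w,
    (u *m ev w) 0 0 = \sum_g b g * detword F pos (wperm w g).
Proof.
case/cyclic_mxP=> A /envelop_mxP[b ->] ->.
exists (fun g => b g * #|row_stab n la|%:R) => w.
rewrite mulmx_sumr mulmx_suml summxE; apply: eq_big => [g|g _]; first by rewrite inE.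
rewrite -scalemxAr -scalemxAl mxE -mulmxA regular_ev.
by rewrite young_ev colsumE mulrA.
Qed.

Lemma submod_ev_lie (u : 'rV[F]_#|G|) (w : word) (X : 'M[F]_a) : (u <= U)%MS ->
  \sum_i \sum_s X (w i) s * (u *m ev (upd w i s)) 0 0
    = #|C|%:R * \tr X * (u *m ev w) 0 0.
Proof.
case/submod_ev=> b evb; rewrite evb mulr_sumr.
transitivity (\sum_g b g * \sum_i \sum_s X (w i) s
                * detword F pos (wperm (upd w i s) g)).
  under eq_bigr do under eq_bigr do rewrite evb mulr_sumr.
  under eq_bigr do rewrite exchange_big /=.
  rewrite exchange_big /=; apply: eq_bigr => g _; rewrite mulr_sumr.
  by apply: eq_bigr => i _; rewrite mulr_sumr; apply: eq_bigr => s _; ring.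
apply: eq_bigr => g _; rewrite [RHS]mulrCA; congr (_ * _).
rewrite -detword_lie // (reindex_inj (@perm_inj _ g)) /=.
apply: eq_bigr => i _; apply: eq_bigr => s _.
by rewrite upd_perm ffunE.
Qed.

Lemma gring_row_regular (x : 'S_n) (k : 'I_#|G|) :
  gring_row (aG x) 0 k = (enum_val k == x)%:R.
Proof.
rewrite /gring_row !mxE eqxx /= gring_indexK ?inE // mul1g.
by rewrite -(inj_eq enum_val_inj) gring_indexK ?inE.
Qed.

Lemma row_stabV s : (s^-1 \in row_stab n la)%g = (s \in row_stab n la).
Proof.
suff stabV t : t \in row_stab n la -> (t^-1 \in row_stab n la)%g.
  by apply/idP/idP=> /stabV //; rewrite invgK.
by move=> Rt; rewrite row_stabP -(row_stab_wperm _ Rt) wpermM mulgV wperm1.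
Qed.

(** Every element of the right ideal is a sum over orbits of the row group
    acting on the left. *)
Lemma submod_row_orbit_sum (u : 'rV[F]_#|G|) : (u <= U)%MS ->
  exists b : 'S_n * 'S_n -> F,
    u = \sum_(p in row_stab n la) \sum_i b i *: gring_row (aG (p * (i.1 * i.2))%g).
Proof.
case/cyclic_mxP=> A /envelop_mxP[b ->] ->.
exists (fun i => if i.1 \in col_stab n la then (-1) ^+ i.1 * b i.2 else 0).
rewrite -gring_row_mul /young_symmetrizer -mulmxA mulmx_suml linear_sum /=.
apply: eq_bigr => p _; rewrite -(pair_bigA _ (fun q g => (if q \in col_stab n la
  then (-1) ^+ q * b g else 0) *: gring_row (aG (p * (q * g))%g))) /=.
rewrite mulmx_suml mulmx_sumr linear_sum big_mkcond /=; apply: eq_bigr => q _.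
case: ifP => Cq; last by rewrite big1 // => g _; rewrite scale0r.
rewrite mulmx_sumr mulmx_sumr linear_sum /=; apply: eq_big => g; first by rewrite inE.
move=> _; rewrite -scalemxAl -!scalemxAr !linearZ /= scalerA.
by rewrite -!repr_mxM ?inE.
Qed.

(** The coefficients of [u] are constant on left orbits of the row group, so
    the coefficient of [h] is, up to the order of the row group, the
    coordinate of [row . u] at the word [row . h]. *)
Lemma submod_ev_inj (u : 'rV[F]_#|G|) : (u <= U)%MS ->
  (forall w, (u *m ev w) 0 0 = 0) -> u = 0.
Proof.
case/submod_row_orbit_sum=> b def_u u0; apply/rowP=> k; rewrite [RHS]mxE.
apply: (mulfI card_row_stab_neq0); rewrite mulr0.
set h := enum_val k; rewrite -(u0 (wperm row h^-1%g)).
rewrite {2}def_u mulmx_suml summxE mulr_natl -sumr_const.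
apply: eq_bigr => p Rp.
rewrite def_u summxE mulmx_suml summxE.
under eq_bigr do rewrite summxE.
rewrite exchange_big /=; apply: eq_bigr => i _.
rewrite -scalemxAl mxE gring_row_ev regular_ev ev_gring1.
rewrite -wpermM row_stab_wperm // wpermM -row_stabP -row_stabV invMg invgK.
under eq_bigr do rewrite mxE gring_row_regular -/h eq_sym.
rewrite -mulr_sumr; congr (_ * _).
have [Rhi|nRhi] := boolP (_ \in _).
  rewrite (bigD1 (h * (i.1 * i.2)^-1)%g) //= mulgKV eqxx big1 ?addr0 // => s.
  case/andP=> _ neq_s; case: eqP => // eq_s.
  by case/eqP: neq_s; rewrite -eq_s mulgK.
rewrite big1 // => s Rs; case: eqP => // eq_s.
by rewrite -eq_s mulgK Rs in nRhi.
Qed.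

End YoungSymmetrizer.

Section RectangularSpecht.

Variables (F : fieldType) (n a m : nat).
Hypothesis char0 : forall k, k.+1%:R != 0 :> F.
Hypothesis n_am : n = (a * m)%N.

Local Notation G := [set: 'S_n]%G.
Local Notation aG := (regular_repr F G).
Local Notation word := {ffun 'I_n -> 'I_a}.
Local Notation la := (nseq a m).
Local Notation U := (cyclic_mx aG (gring_row (young_symmetrizer F n la))).
Local Notation rho := (specht F n la).

Lemma rectangle_positions :
  exists (pos : 'I_m -> 'I_a -> 'I_n) (row : word),
    [/\ bijective (fun p => pos p.1 p.2),
        forall j r, row (pos j r) = r,
        forall i, row i = reshape_index la i :> nat
      & forall j j' r r',
          (reshape_offset la (pos j r) == reshape_offset la (pos j' r'))
            = (j == j')].
Proof.
have n_la : n = sumn la by rewrite sumn_nseq mulnC.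
have nth_la (j : 'I_m) (r : 'I_a) : (j < nth 0 la r)%N.
  by rewrite nth_nseq ltn_ord.
have pos_lt (j : 'I_m) (r : 'I_a) : (flatten_index la r j < n)%N.
  by rewrite n_la flatten_indexP.
have row_lt (i : 'I_n) : (reshape_index la i < a)%N.
  by rewrite -[X in (_ < X)%N](size_nseq a m) reshape_indexP // -n_la.
have col_lt (i : 'I_n) : (reshape_offset la i < m)%N.
  have := @reshape_offsetP la i; rewrite -n_la ltn_ord nth_nseq row_lt; exact.
exists (fun j r => Ordinal (pos_lt j r)), [ffun i => Ordinal (row_lt i)].
split=> [|j r|i|j j' r r'].
- exists (fun i => (Ordinal (col_lt i), Ordinal (row_lt i))) => [[j r]|i].
    by congr (_, _); apply/val_inj; rewrite /= ?flatten_indexKr ?flatten_indexKl.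
  by apply/val_inj; rewrite /= reshape_indexK.
- by rewrite ffunE; apply/val_inj; rewrite /= flatten_indexKl.
- by rewrite ffunE.
- by rewrite /= !flatten_indexKr.
Qed.

(** The only facts on Specht modules used later, in terms of the coordinate
    functionals [c w], one for each word, seen as column vectors: they
    are permuted by the group, semi-invariant under [gl_a], they separate the
    elements of the module (by a resolution of the identity, which passes to
    tensor products), and the module contains the product of determinants
    of every arrangement of the positions in columns. *)
Lemma specht_coordinates :
  exists c : word -> 'cV[F]_(rdegree rho),
    [/\ forall g w, rho g *m c w = c (wperm w g),
        forall (w : word) (X : 'M[F]_a),
          \sum_i \sum_s X (w i) s *: c (upd w i s) = (m%:R * \tr X) *: c w,
        exists d : word -> 'rV[F]_(rdegree rho), \sum_w c w *m d w = 1%:M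
      & forall (C : finType) (pos : C -> 'I_a -> 'I_n),
          #|C| = m -> bijective (fun p => pos p.1 p.2) ->
        exists x : 'rV[F]_(rdegree rho),
          forall w, (x *m c w) 0 0 = detword F pos w].
Proof.
have [pos [row [pos_bij row_pos row_la col_la]]] := rectangle_positions.
pose c w : 'cV[F]_(rdegree rho) := val_submod (1%:M : 'M_(\rank U)) *m ev F row w.
have cE (x : 'rV_(rdegree rho)) w : x *m c w = val_submod x *m ev F row w.
  by rewrite /c mulmxA -val_submodE.
exists c; split=> [g w|w X||C pos' cardC pos'_bij].
- rewrite /c /= mulmxA -val_submodE -[submod_mx _ g]mul1mx val_submodJ ?inE //.
  by rewrite -mulmxA regular_ev.
- apply/colP=> i.
  have c_row w' : c w' i 0 = (matrix.row i (val_submod (1%:M : 'M_(\rank U)))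
                                *m ev F row w') 0 0.
    by rewrite -row_mul [RHS]mxE.
  rewrite [RHS]mxE c_row.
  have := submod_ev_lie char0 pos_bij row_pos row_la col_la w X
    (submx_trans (row_sub i _) (val_submodP (1%:M : 'M_(\rank U)))).
  rewrite card_ord => <-; rewrite summxE; apply: eq_bigr => k _.
  by rewrite summxE; apply: eq_bigr => s _; rewrite mxE c_row.
(* The functionals have no common kernel, hence the matrix that they form
   has a right inverse. *)
- pose T := \matrix_(i < rdegree rho, j < #|{: word}|) c (enum_val j) i 0.
  have /row_freeP[B TB] : row_free T.
    apply: inj_row_free => x xT0; apply/eqP; rewrite -val_submod_eq0; apply/eqP.
    apply: (submod_ev_inj char0 row_la (val_submodP _)) => w.
    rewrite -cE; move/rowP/(_ (enum_rank w)): xT0.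
    rewrite [RHS]mxE => <-; rewrite [LHS]mxE [RHS]mxE; apply: eq_bigr => i _.
    by rewrite [T _ _]mxE enum_rankK.
  exists (fun w => matrix.row (enum_rank w) B); rewrite -TB.
  apply/matrixP=> i j; rewrite summxE [RHS]mxE (reindex _ (onW_bij _ (enum_val_bij word))) /=.
  apply: eq_bigr => k _; rewrite mxE big_ord1 [T _ _]mxE [matrix.row _ _ _ _]mxE.
  by rewrite enum_valK.
have [theta theta_bij] : exists f : C -> 'I_m, bijective f.
  by exists (fun j => cast_ord cardC (enum_rank j));
     apply: bij_comp (enum_rank_bij C); exists (cast_ord (esym cardC)) => i;
     rewrite ?cast_ordK ?cast_ordKV.
have [posV posK posVK] := pos_bij.
have [thetaV thetaK thetaVK] := theta_bij.
pose g_fun i := pos' (thetaV (posV i).1) (posV i).2.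
have g_inj : injective g_fun.
  move=> i i' /eqP; rewrite /g_fun pos_eq // => /andP[/eqP e1 /eqP e2].
  rewrite -(posVK i) -(posVK i') [posV i]surjective_pairing.
  by rewrite [posV i']surjective_pairing e2 (can_inj thetaVK e1).
pose g := perm g_inj.
have gE j r : g (pos (theta j) r) = pos' j r.
  by rewrite permE /g_fun (posK (theta j, r)) /= thetaK.
pose y := #|row_stab n la|%:R^-1 *: (gring_row (young_symmetrizer F n la) *m aG g).
exists (in_submod U y) => w; rewrite cE in_submodK; last first.
  by rewrite scalemx_sub // mxmodule_trans ?cyclic_mx_module ?cyclic_mx_id ?inE.
rewrite -scalemxAl mxE -mulmxA regular_ev (young_ev _ row_la).
rewrite mulKf ?(card_row_stab_neq0 char0 row_la) //.
rewrite (colsumE char0 pos_bij row_pos col_la).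
rewrite /detword (reindex _ (onW_bij _ theta_bij)) /=.
apply: eq_bigr => j _; congr (\det _); apply: eq_lettermx => r /=.
by rewrite ffunE gE.
Qed.

End RectangularSpecht.

(** * A criterion for a Kronecker coefficient to be one *)

(* The products of three columns have width [1 * 1 * 1], which is only
   convertible to [1]. *)
Local Notation o1 := (@ord0 0 : 'I_(1 * 1 * 1)).

Section TripleWords.

Variables (F : fieldType) (n a1 a2 a3 : nat).

Local Notation J := ('I_a1 * 'I_a2 * 'I_a3)%type.
Local Notation G := [set: 'S_n]%G.

Definition wfst (w : {ffun 'I_n -> J}) : {ffun 'I_n -> 'I_a1} :=
  [ffun i => (w i).1.1].
Definition wsnd (w : {ffun 'I_n -> J}) : {ffun 'I_n -> 'I_a2} :=
  [ffun i => (w i).1.2].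
Definition wthd (w : {ffun 'I_n -> J}) : {ffun 'I_n -> 'I_a3} :=
  [ffun i => (w i).2].

(** The Lie algebra of [GL_a1 x GL_a2 x GL_a3] moves [x0] in all
    directions, that is, the orbit of [x0] is open. *)
Definition tangent_full (x0 : J -> F) : Prop :=
  forall y : J -> F, exists (X1 : 'M[F]_a1) (X2 : 'M[F]_a2) (X3 : 'M[F]_a3),
    forall q, \sum_p X1 p q.1.1 * x0 (p, q.1.2, q.2)
              + \sum_p X2 p q.1.2 * x0 (q.1.1, p, q.2)
              + \sum_p X3 p q.2 * x0 (q.1.1, q.1.2, p) = y q.

(** The value at [x] of the invariant polynomial obtained by contracting
    copies of [x], one for each position, with determinants on the columns of
    three arrangements of the positions (a symbolic bracket monomial). *)
Definition detform (P : finType) (C1 C2 C3 : finType) (pos1 : C1 -> 'I_a1 -> P)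
    (pos2 : C2 -> 'I_a2 -> P) (pos3 : C3 -> 'I_a3 -> P) (x : J -> F) : F :=
  \sum_(w : {ffun P -> J})
    detword F pos1 (fun i => (w i).1.1) * detword F pos2 (fun i => (w i).1.2)
      * detword F pos3 (fun i => (w i).2) * \prod_i x (w i).

Section Coordinates.

Variables (r1 r2 r3 : nat) (m1 m2 m3 : nat).
Variables (rho1 : mx_representation F G r1) (rho2 : mx_representation F G r2).
Variables (rho3 : mx_representation F G r3).
Local Notation rho := (prod_repr (prod_repr rho1 rho2) rho3).

Variables (c1 : {ffun 'I_n -> 'I_a1} -> 'cV[F]_r1).
Variables (c2 : {ffun 'I_n -> 'I_a2} -> 'cV[F]_r2).
Variables (c3 : {ffun 'I_n -> 'I_a3} -> 'cV[F]_r3).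
Hypothesis c1J : forall g w, rho1 g *m c1 w = c1 (wperm w g).
Hypothesis c2J : forall g w, rho2 g *m c2 w = c2 (wperm w g).
Hypothesis c3J : forall g w, rho3 g *m c3 w = c3 (wperm w g).

Definition coev u1 u2 u3 : 'M[F]_(r1 * r2 * r3, 1 * 1 * 1) :=
  tprod (tprod (c1 u1) (c2 u2)) (c3 u3).

Lemma coev_resolution d1 d2 d3 :
    \sum_u c1 u *m d1 u = 1%:M -> \sum_u c2 u *m d2 u = 1%:M ->
    \sum_u c3 u *m d3 u = 1%:M ->
  1%:M = \sum_u1 \sum_u2 \sum_u3
    coev u1 u2 u3 *m tprod (tprod (d1 u1) (d2 u2)) (d3 u3).
Proof.
move=> c1d1 c2d2 c3d3; transitivity (tprod (tprod (1%:M : 'M[F]_r1) (1%:M : 'M_r2))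
                        (1%:M : 'M_r3)).
  by rewrite !tprod1.
rewrite -c1d1 -c2d2 -c3d3; apply: etrans (tprod3_sum _ _ _) _.
apply: eq_bigr => u1 _; apply: eq_bigr => u2 _; apply: eq_bigr => u3 _.
by rewrite !tprodE.
Qed.

(** The same functionals, with the three words merged into one word over
    triples, whose positions the symmetric group permutes. *)
Definition wcoev w := coev (wfst w) (wsnd w) (wthd w).

Lemma wcoevJ g w : rho g *m wcoev w = wcoev (wperm w g).
Proof.
transitivity (tprod (tprod (rho1 g *m c1 (wfst w)) (rho2 g *m c2 (wsnd w)))
                    (rho3 g *m c3 (wthd w))); first by rewrite !tprodE.
rewrite c1J c2J c3J.
by congr (tprod (tprod (c1 _) (c2 _)) (c3 _)); apply/ffunP=> i; rewrite !ffunE.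
Qed.

Lemma coev_lie1 (X : 'M[F]_a1) z (u1 : {ffun 'I_n -> 'I_a1})
    (u2 : {ffun 'I_n -> 'I_a2}) (u3 : {ffun 'I_n -> 'I_a3}) :
    (\sum_i \sum_s X (u1 i) s *: c1 (upd u1 i s) = z *: c1 u1) ->
  \sum_i \sum_s X (u1 i) s *: coev (upd u1 i s) u2 u3 = z *: coev u1 u2 u3.
Proof.
move=> lieX; rewrite /coev -!tprodZl -lieX !tprod_suml; apply: eq_bigr => i _.
by rewrite !tprod_suml; apply: eq_bigr => s _; rewrite !tprodZl.
Qed.

Lemma coev_lie2 (X : 'M[F]_a2) z (u1 : {ffun 'I_n -> 'I_a1})
    (u2 : {ffun 'I_n -> 'I_a2}) (u3 : {ffun 'I_n -> 'I_a3}) :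
    (\sum_i \sum_s X (u2 i) s *: c2 (upd u2 i s) = z *: c2 u2) ->
  \sum_i \sum_s X (u2 i) s *: coev u1 (upd u2 i s) u3 = z *: coev u1 u2 u3.
Proof.
move=> lieX; rewrite /coev -tprodZl -tprodZr -lieX tprod_sumr tprod_suml.
apply: eq_bigr => i _.
by rewrite tprod_sumr tprod_suml; apply: eq_bigr => s _; rewrite tprodZr tprodZl.
Qed.

Lemma coev_lie3 (X : 'M[F]_a3) z (u1 : {ffun 'I_n -> 'I_a1})
    (u2 : {ffun 'I_n -> 'I_a2}) (u3 : {ffun 'I_n -> 'I_a3}) :
    (\sum_i \sum_s X (u3 i) s *: c3 (upd u3 i s) = z *: c3 u3) ->
  \sum_i \sum_s X (u3 i) s *: coev u1 u2 (upd u3 i s) = z *: coev u1 u2 u3.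
Proof.
move=> lieX; rewrite /coev -tprodZr -lieX tprod_sumr.
apply: eq_bigr => i _.
by rewrite tprod_sumr; apply: eq_bigr => s _; rewrite tprodZr.
Qed.

(** The element [X1 (x) 1 (x) 1 + 1 (x) X2 (x) 1 + 1 (x) 1 (x) X3]. *)
Definition liesum (X1 : 'M[F]_a1) (X2 : 'M[F]_a2) (X3 : 'M[F]_a3) (p q : J) : F :=
  X1 p.1.1 q.1.1 * ((p.1.2 == q.1.2) && (p.2 == q.2))%:R
  + X2 p.1.2 q.1.2 * ((p.1.1 == q.1.1) && (p.2 == q.2))%:R
  + X3 p.2 q.2 * ((p.1.1 == q.1.1) && (p.1.2 == q.1.2))%:R.

Lemma sum_fst (V : lmodType F) (f : J -> V) (z : 'I_a1 -> F) (p2 : 'I_a2) (p3 : 'I_a3) :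
  \sum_(q : J) (z q.1.1 * ((p2 == q.1.2) && (p3 == q.2))%:R) *: f q
    = \sum_s z s *: f (s, p2, p3).
Proof.
rewrite (bigID (fun q : J => (p2 == q.1.2) && (p3 == q.2))) /=.
rewrite [X in _ + X]big1 => [|q /negPf->]; last by rewrite mulr0 scale0r.
rewrite addr0 (reindex_onto (fun s => (s, p2, p3)) (fun q : J => q.1.1)) /=.
  apply: eq_big => [s|s _]; first by rewrite !eqxx.
  by rewrite !eqxx mulr1.
by move=> [[s q2] q3] /= /andP[/eqP-> /eqP->].
Qed.

Lemma sum_snd (V : lmodType F) (f : J -> V) (z : 'I_a2 -> F) (p1 : 'I_a1) (p3 : 'I_a3) :
  \sum_(q : J) (z q.1.2 * ((p1 == q.1.1) && (p3 == q.2))%:R) *: f q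
    = \sum_s z s *: f (p1, s, p3).
Proof.
rewrite (bigID (fun q : J => (p1 == q.1.1) && (p3 == q.2))) /=.
rewrite [X in _ + X]big1 => [|q /negPf->]; last by rewrite mulr0 scale0r.
rewrite addr0 (reindex_onto (fun s => (p1, s, p3)) (fun q : J => q.1.2)) /=.
  apply: eq_big => [s|s _]; first by rewrite !eqxx.
  by rewrite !eqxx mulr1.
by move=> [[q1 s] q3] /= /andP[/eqP-> /eqP->].
Qed.

Lemma sum_thd (V : lmodType F) (f : J -> V) (z : 'I_a3 -> F) (p1 : 'I_a1) (p2 : 'I_a2) :
  \sum_(q : J) (z q.2 * ((p1 == q.1.1) && (p2 == q.1.2))%:R) *: f q
    = \sum_s z s *: f (p1, p2, s).
Proof.
rewrite (bigID (fun q : J => (p1 == q.1.1) && (p2 == q.1.2))) /=.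
rewrite [X in _ + X]big1 => [|q /negPf->]; last by rewrite mulr0 scale0r.
rewrite addr0 (reindex_onto (fun s => (p1, p2, s)) (fun q : J => q.2)) /=.
  apply: eq_big => [s|s _]; first by rewrite !eqxx.
  by rewrite !eqxx mulr1.
by move=> [[q1 q2] s] /= /andP[/eqP-> /eqP->].
Qed.

Lemma row_mul_coev (x1 : 'rV_r1) (x2 : 'rV_r2) (x3 : 'rV_r3) u1 u2 u3 :
  ((tprod (tprod x1 x2) x3 : 'rV_(r1 * r2 * r3)) *m coev u1 u2 u3) 0 o1
    = (x1 *m c1 u1) 0 0 * (x2 *m c2 u2) 0 0 * (x3 *m c3 u3) 0 0.
Proof.
transitivity (tprod (tprod (x1 *m c1 u1) (x2 *m c2 u2)) (x3 *m c3 u3) o1 o1).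
  by rewrite !tprodE.
exact: etrans (tprod11 _ _) (congr1 ( *%R^~ _) (tprod11 _ _)).
Qed.

Hypothesis c1L : forall (w : {ffun 'I_n -> 'I_a1}) (X : 'M[F]_a1),
  \sum_i \sum_s X (w i) s *: c1 (upd w i s) = (m1%:R * \tr X) *: c1 w.
Hypothesis c2L : forall (w : {ffun 'I_n -> 'I_a2}) (X : 'M[F]_a2),
  \sum_i \sum_s X (w i) s *: c2 (upd w i s) = (m2%:R * \tr X) *: c2 w.
Hypothesis c3L : forall (w : {ffun 'I_n -> 'I_a3}) (X : 'M[F]_a3),
  \sum_i \sum_s X (w i) s *: c3 (upd w i s) = (m3%:R * \tr X) *: c3 w.

Lemma wcoev_lie X1 X2 X3 :
  exists z, forall w : {ffun 'I_n -> J},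
    \sum_i \sum_q liesum X1 X2 X3 (w i) q *: wcoev (upd w i q) = z *: wcoev w.
Proof.
exists (m1%:R * \tr X1 + m2%:R * \tr X2 + m3%:R * \tr X3) => w.
rewrite !scalerDl -(coev_lie1 _ _ (c1L _ _)) -(coev_lie2 _ _ (c2L _ _)).
rewrite -(coev_lie3 _ _ (c3L _ _)) -!big_split /=; apply: eq_bigr => i _.
under eq_bigr do rewrite !scalerDl.
rewrite !big_split /=; congr (_ + _ + _).
- rewrite (sum_fst (fun q => wcoev (upd w i q)) (X1 (w i).1.1)).
  apply: eq_bigr => s _; rewrite ffunE; congr (_ *: coev _ _ _);
  by apply/ffunP=> j; rewrite !ffunE; case: eqP => [eq_j|_] //=; rewrite ?eq_j.
- rewrite (sum_snd (fun q => wcoev (upd w i q)) (X2 (w i).1.2)).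
  apply: eq_bigr => s _; rewrite ffunE; congr (_ *: coev _ _ _);
  by apply/ffunP=> j; rewrite !ffunE; case: eqP => [eq_j|_] //=; rewrite ?eq_j.
- rewrite (sum_thd (fun q => wcoev (upd w i q)) (X3 (w i).2)).
  apply: eq_bigr => s _; rewrite ffunE; congr (_ *: coev _ _ _);
  by apply/ffunP=> j; rewrite !ffunE; case: eqP => [eq_j|_] //=; rewrite ?eq_j.
Qed.

End Coordinates.

Lemma lieact_liesum X1 X2 X3 (x0 : J -> F) q :
  lieact (liesum X1 X2 X3) x0 q
    = \sum_p X1 p q.1.1 * x0 (p, q.1.2, q.2)
      + \sum_p X2 p q.1.2 * x0 (q.1.1, p, q.2)
      + \sum_p X3 p q.2 * x0 (q.1.1, q.1.2, p).
Proof.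
rewrite /lieact /liesum; under eq_bigr do rewrite mulrC !mulrDl.
rewrite !big_split /=; congr (_ + _ + _).
- rewrite -(sum_fst (V := F^o) x0 (fun p => X1 p q.1.1)); apply: eq_bigr => p _.
  by rewrite ![q.1.2 == _]eq_sym ![q.2 == _]eq_sym.
- rewrite -(sum_snd (V := F^o) x0 (fun p => X2 p q.1.2)); apply: eq_bigr => p _.
  by rewrite ![q.1.1 == _]eq_sym ![q.2 == _]eq_sym.
- rewrite -(sum_thd (V := F^o) x0 (fun p => X3 p q.2)); apply: eq_bigr => p _.
  by rewrite ![q.1.1 == _]eq_sym ![q.1.2 == _]eq_sym.
Qed.

End TripleWords.

Section KroneckerCriterion.

Variables (F : fieldType) (n a1 m1 a2 m2 a3 m3 : nat).
Hypothesis char0 : forall k, k.+1%:R != 0 :> F.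
Hypotheses (n_am1 : n = (a1 * m1)%N) (n_am2 : n = (a2 * m2)%N).
Hypothesis (n_am3 : n = (a3 * m3)%N).

Local Notation J := ('I_a1 * 'I_a2 * 'I_a3)%type.
Local Notation G := [set: 'S_n]%G.
Local Notation rho1 := (specht F n (nseq a1 m1)).
Local Notation rho2 := (specht F n (nseq a2 m2)).
Local Notation rho3 := (specht F n (nseq a3 m3)).
Local Notation r1 := (rdegree rho1).
Local Notation r2 := (rdegree rho2).
Local Notation r3 := (rdegree rho3).
Local Notation rho := (prod_repr (prod_repr rho1 rho2) rho3).

(** An invariant vector of the triple product is a symmetric form that is
    semi-invariant under the three Lie algebras.  By [tangent_vanish] it is
    determined by its value on the diagonal at [x0], so there is at most one
    up to a scalar.  Conversely the sum over the group of a product of column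
    determinants is invariant, and its value at [x0] is a nonzero multiple of
    that of the product. *)
Theorem kronecker_eq1 (x0 : J -> F) (C1 C2 C3 : finType)
    (pos1 : C1 -> 'I_a1 -> 'I_n) (pos2 : C2 -> 'I_a2 -> 'I_n)
    (pos3 : C3 -> 'I_a3 -> 'I_n) :
    #|C1| = m1 -> #|C2| = m2 -> #|C3| = m3 ->
    bijective (fun p => pos1 p.1 p.2) -> bijective (fun p => pos2 p.1 p.2) ->
    bijective (fun p => pos3 p.1 p.2) ->
    tangent_full x0 -> detform pos1 pos2 pos3 x0 != 0 ->
  kronecker F n (nseq a1 m1) (nseq a2 m2) (nseq a3 m3) = 1%N.
Proof.
move=> cardC1 cardC2 cardC3 bij1 bij2 bij3 tangent nz.
have [c1 [c1J c1L [d1 c1d1] c1D]] := specht_coordinates char0 n_am1.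
have [c2 [c2J c2L [d2 c2d2] c2D]] := specht_coordinates char0 n_am2.
have [c3 [c3J c3L [d3 c3d3] c3D]] := specht_coordinates char0 n_am3.
pose cw := wcoev c1 c2 c3.
(* [v *m E] is the value at [x0] of the polynomial attached to [v]. *)
pose E : 'M[F]_(r1 * r2 * r3, 1 * 1 * 1) :=
  \sum_(w : {ffun 'I_n -> J}) (\prod_i x0 (w i)) *: cw w.
have vE v : (v *m E) 0 o1 = mform (fun w => (v *m cw w) 0 o1) (fun=> x0).
  rewrite mulmx_sumr summxE; apply: eq_bigr => w _.
  by rewrite -scalemxAr mxE mulrC.
have rhoE g : rho g *m E = E.
  rewrite mulmx_sumr [RHS](reindex (@wperm n J ^~ g)) /=; last first.
    exact/onW_bij/wperm_bij.
  apply: eq_bigr => w _; rewrite -scalemxAr (wcoevJ c1J c2J c3J); congr (_ *: _).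
  rewrite (reindex_inj (@perm_inj _ g)) /=.
  by apply: eq_bigr => i _; rewrite ffunE.
have coev_inj (v : 'rV_(r1 * r2 * r3)) :
    (forall u1 u2 u3, v *m coev c1 c2 c3 u1 u2 u3 = 0) -> v = 0.
  move=> v0; rewrite -[v]mulmx1 (coev_resolution c1d1 c2d2 c3d3).
  rewrite mulmx_sumr big1 // => u1 _; rewrite mulmx_sumr big1 // => u2 _.
  by rewrite mulmx_sumr big1 // => u3 _; rewrite mulmxA v0 mul0mx.
have fix_inj (v : 'rV_(r1 * r2 * r3)) : (v <= rfix_mx rho G)%MS -> v *m E = 0 -> v = 0.
  move=> /rfix_mxP fixv vE0; apply: coev_inj => u1 u2 u3.
  pose w := [ffun i => (u1 i, u2 i, u3 i)] : {ffun 'I_n -> J}.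
  have -> : coev c1 c2 c3 u1 u2 u3 = cw w.
    by congr (coev _ _ _ _ _ _); apply/ffunP=> i; rewrite !ffunE.
  apply/matrixP=> i j; rewrite [RHS]mxE.
  have -> : i = 0 by exact: ord1.
  have -> : j = o1 by exact: ord1.
  apply: (@tangent_vanish F n J char0 (fun w => (v *m cw w) 0 o1) x0) => {w}.
  - by move=> w s; rewrite /cw -(wcoevJ c1J c2J c3J) mulmxA fixv ?inE.
  - move=> y; have [X1 [X2 [X3 Xy]]] := tangent y.
    exists (liesum X1 X2 X3); last by move=> q; rewrite lieact_liesum Xy.
    have [z lieX] := wcoev_lie c1L c2L c3L X1 X2 X3.
    exists z => w; transitivity ((v *m (z *: cw w)) 0 o1).
      rewrite -lieX mulmx_sumr summxE; apply: eq_bigr => k _.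
      rewrite mulmx_sumr summxE; apply: eq_bigr => q _.
      by rewrite -scalemxAr [RHS]mxE.
    by rewrite -scalemxAr mxE.
  - by rewrite -vE vE0 mxE.
have [x1 x1D] := c1D C1 pos1 cardC1 bij1.
have [x2 x2D] := c2D C2 pos2 cardC2 bij2.
have [x3 x3D] := c3D C3 pos3 cardC3 bij3.
pose v0 : 'rV_(r1 * r2 * r3) := tprod (tprod x1 x2) x3.
have v0E : (v0 *m E) 0 o1 = detform pos1 pos2 pos3 x0.
  rewrite vE; apply: eq_bigr => w _; congr (_ * _).
  rewrite row_mul_coev x1D x2D x3D; congr (_ * _ * _);
  by apply: eq_detword => i; rewrite ffunE.
pose v := \sum_(g : 'S_n) v0 *m rho g.
have fixv : (v <= rfix_mx rho G)%MS.
  apply/rfix_mxP=> h _; rewrite mulmx_suml [RHS](reindex_inj (mulIg h)) /=.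
  apply: eq_bigr => g _; rewrite -mulmxA; congr (_ *m _).
  by apply: esym; apply: (repr_mxM rho); rewrite inE.
have nz_v : v != 0.
  apply: contraNneq nz => v_eq0; rewrite -v0E.
  have : (v *m E) 0 o1 = 0 by rewrite v_eq0 mul0mx mxE.
  rewrite mulmx_suml summxE.
  under eq_bigr do rewrite -mulmxA rhoE.
  rewrite sumr_const -mulr_natl => /eqP; rewrite mulf_eq0 => /orP[|//].
  rewrite card_Sn; case: _`! (fact_gt0 n) => // k _ /eqP k0.
  by case/eqP: (char0 k).
rewrite /kronecker; apply/eqP; rewrite eqn_leq; apply/andP; split.
  rewrite -(mxrank_mul_ker (rfix_mx rho G) E).
  rewrite (_ : (_ :&: _)%MS = 0) ?mxrank0 ?addn0 ?rank_leq_col //.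
  apply/eqP/rowV0P=> u; rewrite sub_capmx => /andP[fixu /sub_kermxP].
  exact: fix_inj.
by apply: leq_trans (mxrankS fixv); rewrite rank_rV nz_v.
Qed.

End KroneckerCriterion.

(** * Powers of an invariant *)

Section BlockPowers.

Variables (F : fieldType) (a1 a2 a3 : nat).

Local Notation J := ('I_a1 * 'I_a2 * 'I_a3)%type.

Variables (x : J -> F) (C1 C2 C3 : finType).

Lemma detform_reindex (P Q : finType) (pos1 : C1 -> 'I_a1 -> P)
    (pos2 : C2 -> 'I_a2 -> P) (pos3 : C3 -> 'I_a3 -> P) (beta : P -> Q) :
    bijective beta ->
  detform (fun j r => beta (pos1 j r)) (fun j r => beta (pos2 j r))
    (fun j r => beta (pos3 j r)) x = detform pos1 pos2 pos3 x.
Proof.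
move=> beta_bij; have [betaV betaK betaVK] := beta_bij.
rewrite /detform (reindex (fun w : {ffun P -> J} => [ffun i => w (betaV i)])) /=.
  apply: eq_bigr => w _; congr (_ * _ * _ * _).
  - by apply: eq_bigr => j _; congr (\det _); apply: eq_lettermx => r /=;
      rewrite ffunE betaK.
  - by apply: eq_bigr => j _; congr (\det _); apply: eq_lettermx => r /=;
      rewrite ffunE betaK.
  - by apply: eq_bigr => j _; congr (\det _); apply: eq_lettermx => r /=;
      rewrite ffunE betaK.
  rewrite (reindex _ (onW_bij _ beta_bij)) /=.
  by apply: eq_bigr => i _; rewrite ffunE betaK.
apply: onW_bij; exists (fun w : {ffun Q -> J} => [ffun i => w (beta i)]) => w.
  by apply/ffunP=> i; rewrite !ffunE betaK.
by apply/ffunP=> i; rewrite !ffunE betaVK.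
Qed.

Variables (K P : finType).
Variables (pos1 : C1 -> 'I_a1 -> P) (pos2 : C2 -> 'I_a2 -> P).
Variable (pos3 : C3 -> 'I_a3 -> P).

(** [K] copies of an arrangement, side by side. *)
Definition blocks (C : finType) a (pos : C -> 'I_a -> P) (j : K * C) (r : 'I_a) :
  K * P := (j.1, pos j.2 r).

Lemma detword_blocks (C : finType) a (pos : C -> 'I_a -> P) w :
  detword F (blocks pos) w = \prod_k detword F pos (fun i => w (k, i)).
Proof.
rewrite /detword.
by rewrite (pair_bigA _ (fun k j => \det (lettermx F ((fun i => w (k, i)) \o pos j)))).
Qed.

(** A word on the union of the blocks is a choice of one word for each block,
    and the column determinants do not mix the blocks. *)
Lemma detform_blocks :
  detform (blocks pos1) (blocks pos2) (blocks pos3) x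
    = detform pos1 pos2 pos3 x ^+ #|K|.
Proof.
rewrite -prodr_const.
rewrite [RHS](eq_bigr (fun=> detform pos1 pos2 pos3 x)) // bigA_distr_bigA /=.
rewrite /detform (reindex (fun f : {ffun K -> {ffun P -> J}} =>
                             [ffun i : K * P => f i.1 i.2])) /=.
  apply: eq_bigr => f _; rewrite !detword_blocks !big_split /=.
  congr (_ * _ * _ * _).
  - by apply: eq_bigr => k _; apply: eq_detword => i; rewrite ffunE.
  - by apply: eq_bigr => k _; apply: eq_detword => i; rewrite ffunE.
  - by apply: eq_bigr => k _; apply: eq_detword => i; rewrite ffunE.
  rewrite (pair_bigA _ (fun k i => x (f k i))) /=.
  by apply: eq_bigr => i _; rewrite ffunE.
apply: onW_bij; exists (fun w : {ffun K * P -> J} => [ffun k => [ffun i => w (k, i)]]).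
  by move=> f; apply/ffunP=> k; apply/ffunP=> i; rewrite !ffunE.
by move=> w; apply/ffunP=> -[k i]; rewrite !ffunE.
Qed.

Lemma blocks_bij (C : finType) a (pos : C -> 'I_a -> P) :
  bijective (fun p => pos p.1 p.2) -> bijective (fun p => blocks pos p.1 p.2).
Proof.
case=> q posK qK; exists (fun i : K * P => ((i.1, (q i.2).1), (q i.2).2)).
  by move=> [[k j] r] /=; rewrite (posK (j, r)).
by move=> [k i] /=; rewrite /blocks /= [pos _ _]qK.
Qed.

End BlockPowers.

(** The open orbit bounds all multiples at once, since the tensor [x0] does not
    depend on the degree, and the power of one invariant that is nonzero at
    [x0] provides an invariant in each multiple of its degree. *)
Theorem kronecker_multiples (F : fieldType) (n a1 m1 a2 m2 a3 m3 : nat)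
    (x0 : 'I_a1 * 'I_a2 * 'I_a3 -> F)
    (pos1 : 'I_m1 -> 'I_a1 -> 'I_n) (pos2 : 'I_m2 -> 'I_a2 -> 'I_n)
    (pos3 : 'I_m3 -> 'I_a3 -> 'I_n) :
    (forall k, k.+1%:R != 0 :> F) ->
    bijective (fun p => pos1 p.1 p.2) -> bijective (fun p => pos2 p.1 p.2) ->
    bijective (fun p => pos3 p.1 p.2) ->
    tangent_full x0 -> detform pos1 pos2 pos3 x0 != 0 ->
  forall k, kronecker F (k * n) (nseq a1 (k * m1)) (nseq a2 (k * m2))
              (nseq a3 (k * m3)) = 1%N.
Proof.
move=> char0 bij1 bij2 bij3 tangent nz k.
have card_n m a (pos : 'I_m -> 'I_a -> 'I_n) :
    bijective (fun p => pos p.1 p.2) -> (k * n = a * (k * m))%N.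
  by move/bij_eq_card; rewrite card_prod !card_ord => <-; rewrite mulnA mulnC.
have cardP : #|{: 'I_k * 'I_n}| = (k * n)%N by rewrite card_prod !card_ord.
pose beta (i : 'I_k * 'I_n) : 'I_(k * n) := cast_ord cardP (enum_rank i).
have beta_bij : bijective beta.
  by apply: inj_card_bij; [apply: inj_comp (@cast_ord_inj _ _ _) enum_rank_inj
                          | rewrite card_ord cardP].
apply: (kronecker_eq1 char0 (card_n _ _ _ bij1) (card_n _ _ _ bij2)
  (card_n _ _ _ bij3) (pos1 := fun j r => beta (blocks pos1 j r))
  (pos2 := fun j r => beta (blocks pos2 j r))
  (pos3 := fun j r => beta (blocks pos3 j r))) tangent _.
- by rewrite card_prod !card_ord.
- by rewrite card_prod !card_ord.
- by rewrite card_prod !card_ord.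
- exact: bij_comp beta_bij (blocks_bij _ bij1).
- exact: bij_comp beta_bij (blocks_bij _ bij2).
- exact: bij_comp beta_bij (blocks_bij _ bij3).
- by rewrite detform_reindex // detform_blocks expf_neq0.
Qed.

(** * Evaluation of an invariant by a finite search *)

Local Notation letter := (nat * nat * nat)%type.

(** The determinant of the matrix whose rows are the basis vectors numbered
    by [s], by expansion along the first row; [a] bounds the length of [s]
    and only serves the termination of the recursion. *)
Fixpoint column_sign (a : nat) (s : seq nat) : int :=
  if (a, s) is (a'.+1, l :: s') then
    if l \in s' then 0 else (-1) ^+ l * column_sign a' [seq unbump l x | x <- s']
  else 1.

Lemma column_sign_uniq a s : (size s <= a)%N -> ~~ uniq s -> column_sign a s = 0.
Proof.
elim: a s => [|a IHa] [|l s] //= le_s.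
case: ifP => //= nls nus; rewrite IHa ?mulr0 ?size_map //.
by apply: contra nus; apply: map_uniq.
Qed.

Lemma det_lettermx (F : fieldType) a (w : 'I_a -> 'I_a) :
  \det (lettermx F w) = (column_sign a [seq (w r : nat) | r <- enum 'I_a])%:~R.
Proof.
elim: a w => [|a IHa] w; first by rewrite det_mx00 enum_ord0.
rewrite enum_ordSl /= -map_comp; set l := w ord0.
case: ifP => [|/negP nl].
  case/mapP=> r _ /= /val_inj eq_w.
  apply: (determinant_alternate (neq_lift ord0 r)) => s.
  by rewrite !mxE -eq_w.
have neq_l r : l != w (lift ord0 r).
  by apply/eqP=> eq_l; apply: nl; apply/mapP; exists r; rewrite ?mem_enum //= -eq_l.
pose w' r := odflt r (unlift l (w (lift ord0 r))).
have w'E r : w (lift ord0 r) = lift l (w' r).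
  by rewrite /w'; have [j def_w ->] := unlift_some (neq_l r).
rewrite (expand_det_row _ ord0) (bigD1 l) //= mxE eqxx mul1r big1 ?addr0; last first.
  by move=> s neq_s; rewrite mxE eq_sym (negPf neq_s) mul0r.
rewrite /cofactor add0n rmorphM rmorph_sign; congr (_ * _).
rewrite -map_comp (eq_map (g := fun r => (w' r : nat))); last first.
  by move=> r /=; rewrite w'E /= bumpK.
transitivity (\det (lettermx F w')); last by rewrite IHa.
congr (\det _); apply/matrixP=> i j; rewrite !mxE w'E.
by rewrite (inj_eq lift_inj).
Qed.

Section WordSums.

Variables (T : eqType) (V : zmodType) (S : seq T).

Fixpoint wsum n (G : seq T -> V) : V :=
  if n is n'.+1 then \sum_(l <- S) wsum n' (fun t => G (l :: t)) else G [::].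

Lemma eq_wsum n G G' : (forall t, size t = n -> G t = G' t) -> wsum n G = wsum n G'.
Proof.
elim: n G G' => [|n IHn] G G' eG /=; first exact: eG.
by apply: eq_bigr => l _; apply: IHn => t szt; rewrite eG //= szt.
Qed.

Lemma wsum0 n G : (forall t, G t = 0) -> wsum n G = 0.
Proof.
elim: n G => [|n IHn] G G0 //=.
by rewrite big1 // => l _; apply: IHn.
Qed.

End WordSums.

Lemma sum_letters (F : fieldType) (J : finType) (T : eqType) (tau : J -> T)
    (S : seq T) (H : T -> F) :
    injective tau -> uniq S -> {subset S <= codom tau} ->
  \sum_q (tau q \in S)%:R * H (tau q) = \sum_(l <- S) H l.
Proof.
move=> tau_inj uS subS.
rewrite (eq_bigr (fun q => if tau q \in S then H (tau q) else 0)); last first.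
  by move=> q _; case: ifP => _; rewrite ?mul1r ?mul0r.
rewrite -big_mkcond -(big_map tau (mem S) H) -big_filter /=.
apply: perm_big; apply: uniq_perm => // [|l].
  by rewrite filter_uniq // map_inj_uniq // /index_enum -enumT enum_uniq.
rewrite mem_filter /=; case: (boolP (l \in S)) => //= /subS /codomP[q ->].
by rewrite map_f ?mem_index_enum.
Qed.

Lemma sum_words (F : fieldType) (J : finType) (T : eqType) (tau : J -> T)
    (S : seq T) n (G : seq T -> F) :
    injective tau -> uniq S -> {subset S <= codom tau} ->
  \sum_(w : {ffun 'I_n -> J}) G [seq tau (w i) | i <- enum 'I_n]
      * \prod_i (tau (w i) \in S)%:R = wsum S n G.
Proof.
move=> tau_inj uS subS; elim: n G => [|n IHn] G /=.
  rewrite (bigD1 (finfun (fun i : 'I_0 => False_rect J (notF (valP i))))) //=.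
  rewrite big_ord0 mulr1 enum_ord0 big1 ?addr0 // => w.
  by case/eqP; apply/ffunP=> -[].
pose wcons (p : J * {ffun 'I_n -> J}) : {ffun 'I_n.+1 -> J} :=
  [ffun i => if unlift ord0 i is Some j then p.2 j else p.1].
have wcons0 p : wcons p ord0 = p.1 by rewrite ffunE unlift_none.
have wconsS p i : wcons p (lift ord0 i) = p.2 i by rewrite ffunE liftK.
rewrite (reindex wcons) /=; last first.
  apply: onW_bij; exists (fun w : {ffun 'I_n.+1 -> J} =>
                            (w ord0, [ffun i => w (lift ord0 i)])).
    move=> [q w]; rewrite wcons0; congr (_, _).
    by apply/ffunP=> i; rewrite ffunE wconsS.
  move=> w; apply/ffunP=> i; rewrite ffunE.
  by case: unliftP => [j|] -> //=; rewrite ffunE.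
rewrite -(pair_bigA _ (fun q w => G [seq tau (wcons (q, w) i) | i <- enum 'I_n.+1]
  * \prod_i (tau (wcons (q, w) i) \in S)%:R)) /=.
transitivity (\sum_q (tau q \in S)%:R * wsum S n (fun t => G (tau q :: t))).
  apply: eq_bigr => q _; rewrite -IHn mulr_sumr; apply: eq_bigr => w _.
  rewrite big_ord_recl wcons0 mulrCA; congr (_ * (G _ * _)).
    rewrite enum_ordSl /= wcons0 -map_comp; congr (_ :: _).
    by apply: eq_map => i /=; rewrite wconsS.
  by apply: eq_bigr => i _; rewrite wconsS.
exact: (sum_letters (fun l => wsum S n (fun t => G (l :: t)))).
Qed.

Lemma wsum_intr (F : fieldType) (T : eqType) (S : seq T) n (G : seq T -> int) :
  wsum S n (fun t => (G t)%:~R : F) = (wsum S n G)%:~R.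
Proof.
elim: n G => [|n IHn] G //=.
by rewrite rmorph_sum /=; apply: eq_bigr => l _; rewrite IHn.
Qed.

Section PrunedSearch.

Variables (T : eqType) (S : seq T) (ok : pred (seq T)) (G : seq T -> int).

(** The sum of [G] over the words that extend [pre] by [n] letters of [S],
    where a prefix refused by [ok] is abandoned at once; without pruning the
    sums below would have up to [6 ^ 12] terms. *)
Fixpoint search n (pre : seq T) : int :=
  if ~~ ok pre then 0 else
  if n is n'.+1 then foldr (fun l acc => search n' (rcons pre l) + acc) 0 S
  else G pre.

Hypothesis prune : forall pre t, ~~ ok pre -> G (pre ++ t) = 0.

Lemma searchE n pre : search n pre = wsum S n (fun t => G (pre ++ t)).
Proof.
elim: n pre => [|n IHn] pre /=; case: ifP => nok.
- by rewrite prune.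
- by rewrite cats0.
- by rewrite big1 // => l _; apply: wsum0 => t; apply: prune.
have foldrE s : foldr (fun l acc => search n (rcons pre l) + acc) 0 s
                  = \sum_(l <- s) search n (rcons pre l).
  by elim: s => [|l s IHs]; rewrite ?big_nil // big_cons -IHs.
rewrite foldrE; apply: eq_bigr => l _; rewrite IHn.
by apply: eq_wsum => t _; rewrite cat_rcons.
Qed.

End PrunedSearch.

(** An arrangement of the positions in columns of length [a] is given by the
    list [ps] of the positions, one column after the other. *)
Definition column (ps : seq nat) a j : seq nat :=
  [seq nth 0%N ps (j * a + r) | r <- iota 0 a].

Definition columns_ok (f : letter -> nat) ps a m (pre : seq letter) : bool :=
  all (fun j => uniq [seq f (nth (0, 0, 0)%N pre p) | p <- column ps a j & (p < size pre)%N])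
    (iota 0 m).

Definition columns_sign (f : letter -> nat) ps a m (t : seq letter) : int :=
  foldr (fun j z => column_sign a [seq f (nth (0, 0, 0)%N t p) | p <- column ps a j] * z)
    1 (iota 0 m).

Lemma columns_sign_prune f ps a m pre t :
  ~~ columns_ok f ps a m pre -> columns_sign f ps a m (pre ++ t) = 0.
Proof.
rewrite /columns_sign /columns_ok -has_predC.
elim: (iota 0 m) => //= j s IHs /orP[nu|/IHs->]; last by rewrite mulr0.
rewrite column_sign_uniq ?mul0r ?size_map ?size_iota //; apply: contra nu => u.
have eq_pre : [seq f (nth (0, 0, 0)%N pre p) | p <- column ps a j & (p < size pre)%N]
    = [seq f (nth (0, 0, 0)%N (pre ++ t) p) | p <- column ps a j & (p < size pre)%N].
  by apply/eq_in_map=> p; rewrite mem_filter nth_cat => /andP[->].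
by rewrite eq_pre; apply: subseq_uniq u; apply/map_subseq/filter_subseq.
Qed.

Definition good_positions n (ps : seq nat) a m : bool :=
  [&& size ps == n, (m * a)%N == n, uniq ps & all (gtn n) ps].

Definition position n (ps : seq nat) a m (j : 'I_m) (r : 'I_a) : 'I_n.+1 :=
  inord (nth 0%N ps (j * a + r)).

Lemma position_index m a (j : 'I_m) (r : 'I_a) : (j * a + r < m * a)%N.
Proof.
apply: (@leq_trans (j.+1 * a)); last by rewrite leq_mul2r ltn_ord orbT.
by rewrite mulSn addnC ltn_add2r.
Qed.

Lemma positionE n ps a m (j : 'I_m) (r : 'I_a) : good_positions n.+1 ps a m ->
  position n ps j r = nth 0%N ps (j * a + r) :> nat.
Proof.
case/and4P=> /eqP szp /eqP ma _ /allP ltp.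
by rewrite inordK //; apply/ltp/mem_nth; rewrite szp -ma position_index.
Qed.

Lemma position_bij n ps a m : good_positions n.+1 ps a m ->
  bijective (fun p : 'I_m * 'I_a => position n ps p.1 p.2).
Proof.
move=> good; have := good; case/and4P=> /eqP szp /eqP ma up _.
apply: inj_card_bij; last by rewrite card_prod !card_ord ma.
move=> [j r] [j' r'] /= /(congr1 val); rewrite /= !positionE // => /eqP.
rewrite nth_uniq ?szp -?ma ?position_index // => /eqP eq_jr.
have a_gt0 : (0 < a)%N by apply: leq_ltn_trans (ltn_ord r).
congr (_, _); apply/val_inj => /=.
  have := congr1 (divn^~ a) eq_jr.
  by rewrite /= !divnMDl // !divn_small ?addn0.
by have := congr1 (modn^~ a) eq_jr; rewrite /= !modnMDl !modn_small.
Qed.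

Lemma detword_position (F : fieldType) n ps a m (f : letter -> nat)
    (w : 'I_n.+1 -> 'I_a) (t : seq letter) :
    good_positions n.+1 ps a m ->
    (forall i : 'I_n.+1, f (nth (0, 0, 0)%N t i) = w i) ->
  detword F (@position n ps a m) w = (columns_sign f ps a m t)%:~R.
Proof.
move=> good tE; rewrite /detword /columns_sign.
transitivity (\prod_(j <- iota 0 m)
  (column_sign a [seq f (nth (0, 0, 0)%N t p) | p <- column ps a j])%:~R : F); last first.
  elim: (iota 0 m) => [|j s IHs]; first by rewrite big_nil.
  by rewrite big_cons IHs /= rmorphM.
rewrite -val_enum_ord big_map big_enum /=; apply: eq_bigr => j _.
rewrite det_lettermx; congr (column_sign a _)%:~R.
rewrite /column -map_comp -val_enum_ord -map_comp; apply: eq_map => r /=.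
by rewrite -(positionE j r good) tE.
Qed.

Definition letter_value ps1 a1 m1 ps2 a2 m2 ps3 a3 m3 t : int :=
  columns_sign (fun l => l.1.1) ps1 a1 m1 t
    * columns_sign (fun l => l.1.2) ps2 a2 m2 t
    * columns_sign (fun l => l.2) ps3 a3 m3 t.

Definition letter_ok ps1 a1 m1 ps2 a2 m2 ps3 a3 m3 t : bool :=
  [&& columns_ok (fun l => l.1.1) ps1 a1 m1 t,
      columns_ok (fun l => l.1.2) ps2 a2 m2 t
    & columns_ok (fun l => l.2) ps3 a3 m3 t].

Definition triple_val a1 a2 a3 (q : 'I_a1 * 'I_a2 * 'I_a3) : letter :=
  (q.1.1 : nat, q.1.2 : nat, q.2 : nat).

Lemma triple_val_inj a1 a2 a3 : injective (@triple_val a1 a2 a3).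
Proof. by move=> [[i j] k] [[i' j'] k'] [] /val_inj-> /val_inj-> /val_inj->. Qed.

Lemma triple_val_sub a1 a2 a3 (S : seq letter) :
    all (fun l => [&& l.1.1 < a1, l.1.2 < a2 & l.2 < a3]%N) S ->
  {subset S <= codom (@triple_val a1 a2 a3)}.
Proof.
move=> /allP okS [[i j] k] /okS /= /and3P[lti ltj ltk].
by apply/codomP; exists (Ordinal lti, Ordinal ltj, Ordinal ltk).
Qed.

Definition support (F : fieldType) a1 a2 a3 (S : seq letter)
  (q : 'I_a1 * 'I_a2 * 'I_a3) : F := (triple_val q \in S)%:R.

Lemma detform_search (F : fieldType) n a1 m1 a2 m2 a3 m3 ps1 ps2 ps3 S :
    good_positions n.+1 ps1 a1 m1 -> good_positions n.+1 ps2 a2 m2 ->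
    good_positions n.+1 ps3 a3 m3 -> uniq S ->
    all (fun l => [&& l.1.1 < a1, l.1.2 < a2 & l.2 < a3]%N) S ->
  detform (@position n ps1 a1 m1) (@position n ps2 a2 m2) (@position n ps3 a3 m3)
      (@support F a1 a2 a3 S)
    = (search S (letter_ok ps1 a1 m1 ps2 a2 m2 ps3 a3 m3)
         (letter_value ps1 a1 m1 ps2 a2 m2 ps3 a3 m3) n.+1 [::])%:~R.
Proof.
move=> good1 good2 good3 uS okS; rewrite searchE => [|pre t]; last first.
  rewrite /letter_value; case/nandP=> [|/nandP[]] /columns_sign_prune->;
  by rewrite ?(mul0r, mulr0).
rewrite -wsum_intr -(sum_words _ _ (@triple_val_inj a1 a2 a3) uS (triple_val_sub okS)).
apply: eq_bigr => w _; congr (_ * _) => /=.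
have nthE (i : 'I_n.+1) :
    nth (0, 0, 0)%N [seq triple_val (w i) | i <- enum 'I_n.+1] i = triple_val (w i).
  by rewrite (nth_map i) ?size_enum_ord // nth_ord_enum.
rewrite /letter_value !rmorphM; congr (_ * _ * _);
by apply: detword_position => // i; rewrite nthE.
Qed.

(** * The four tensors with open orbit *)

Lemma tangent_nat (F : fieldType) b1 b2 b3 (S : seq letter) :
    (forall Y : nat -> nat -> nat -> F,
       exists X1 X2 X3 : nat -> nat -> F, forall q1 q2 q3 : nat,
         (q1 < b1.+1)%N -> (q2 < b2.+1)%N -> (q3 < b3.+1)%N ->
       \sum_(p < b1.+1) X1 p q1 * ((p : nat, q2, q3) \in S)%:R
       + \sum_(p < b2.+1) X2 p q2 * ((q1, p : nat, q3) \in S)%:R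
       + \sum_(p < b3.+1) X3 p q3 * ((q1, q2, p : nat) \in S)%:R = Y q1 q2 q3) ->
  tangent_full (@support F b1.+1 b2.+1 b3.+1 S).
Proof.
move=> solve y.
have [X1 [X2 [X3 XY]]] := solve (fun i j k => y (inord i, inord j, inord k)).
exists (\matrix_(p, q) X1 p q), (\matrix_(p, q) X2 p q), (\matrix_(p, q) X3 p q).
move=> [[i j] k] /=; have := XY i j k (ltn_ord i) (ltn_ord j) (ltn_ord k).
rewrite !inord_val => <-; congr (_ + _ + _);
by apply: eq_bigr => p _; rewrite mxE.
Qed.

Ltac tangent_entry :=
  rewrite !big_ord_recl !big_ord0 /=; ring.

(** In the four lemmas below the matrices solve, entry by entry, the linear
    system that expresses an arbitrary tensor [Y] as a tangent vector of the
    orbit; the system has several solutions, and the ones given have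
    integral coefficients. *)

(** The sum of two decomposable tensors in general position. *)
Definition support222 : seq letter := [:: (0, 0, 0); (1, 1, 1)]%N.

Lemma tangent222 (F : fieldType) :
  tangent_full (@support F 2 2 2 support222).
Proof.
apply: tangent_nat => Y.
exists (fun p q => match p, q with
  | 0%N, 1%N => Y 1 0 0
  | 1%N, 0%N => Y 0 1 1
  | _, _ => 0 end).
exists (fun p q => match p, q with
  | 0%N, 1%N => Y 0 1 0
  | 1%N, 0%N => Y 1 0 1
  | _, _ => 0 end).
exists (fun p q => match p, q with
  | 0%N, 0%N => Y 0 0 0
  | 0%N, 1%N => Y 0 0 1
  | 1%N, 0%N => Y 1 1 0
  | 1%N, 1%N => Y 1 1 1
  | _, _ => 0 end).
by move=> [|[|?]] [|[|?]] [|[|?]] // _ _ _; tangent_entry.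
Qed.

(** The three-dimensional space of symmetric 2 x 2 matrices, as a tensor. *)
Definition support223 : seq letter := [:: (0, 0, 0); (1, 1, 1); (0, 1, 2); (1, 0, 2)]%N.

Lemma tangent223 (F : fieldType) :
  tangent_full (@support F 2 2 3 support223).
Proof.
apply: tangent_nat => Y.
exists (fun _ _ => 0).
exists (fun p q => match p, q with
  | 0%N, 0%N => - Y 0 1 2 + Y 1 0 2
  | 0%N, 1%N => Y 0 1 0 - Y 1 0 0
  | 1%N, 0%N => - Y 0 1 1 + Y 1 0 1
  | _, _ => 0 end).
exists (fun p q => match p, q with
  | 0%N, 0%N => Y 0 0 0 + Y 0 1 2 - Y 1 0 2
  | 0%N, 1%N => Y 0 0 1
  | 0%N, 2%N => Y 0 0 2 + Y 0 1 1 - Y 1 0 1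
  | 1%N, 0%N => Y 1 1 0
  | 1%N, 1%N => Y 1 1 1
  | 1%N, 2%N => - Y 0 1 0 + Y 1 0 0 + Y 1 1 2
  | 2%N, 0%N => Y 1 0 0
  | 2%N, 1%N => Y 0 1 1
  | 2%N, 2%N => Y 0 1 2
  | _, _ => 0 end).
by move=> [|[|?]] [|[|?]] [|[|[|?]]] // _ _ _; tangent_entry.
Qed.

(** The pencil of diagonal 3 x 3 matrices [diag (s, s + t, t)], with three
    distinct roots. *)
Definition support233 : seq letter := [:: (0, 0, 0); (0, 1, 1); (1, 1, 1); (1, 2, 2)]%N.

Lemma tangent233 (F : fieldType) :
  tangent_full (@support F 2 3 3 support233).
Proof.
apply: tangent_nat => Y.
exists (fun p q => match p, q with
  | 0%N, 0%N => Y 0 1 1 - Y 0 2 2 + Y 1 0 0 - Y 1 1 1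
  | 0%N, 1%N => Y 1 0 0
  | 1%N, 0%N => Y 0 2 2
  | _, _ => 0 end).
exists (fun p q => match p, q with
  | 0%N, 1%N => Y 0 1 0 - Y 1 1 0
  | 0%N, 2%N => Y 0 2 0
  | 1%N, 0%N => Y 1 0 1
  | 1%N, 2%N => Y 0 2 1
  | 2%N, 0%N => Y 1 0 2
  | 2%N, 1%N => - Y 0 1 2 + Y 1 1 2
  | _, _ => 0 end).
exists (fun p q => match p, q with
  | 0%N, 0%N => Y 0 0 0 - Y 0 1 1 + Y 0 2 2 - Y 1 0 0 + Y 1 1 1
  | 0%N, 1%N => Y 0 0 1 - Y 1 0 1
  | 0%N, 2%N => Y 0 0 2
  | 1%N, 0%N => Y 1 1 0
  | 1%N, 1%N => - Y 1 0 0 + Y 1 1 1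
  | 1%N, 2%N => Y 0 1 2
  | 2%N, 0%N => Y 1 2 0
  | 2%N, 1%N => - Y 0 2 1 + Y 1 2 1
  | 2%N, 2%N => Y 1 2 2
  | _, _ => 0 end).
by move=> [|[|?]] [|[|[|?]]] [|[|[|?]]] // _ _ _; tangent_entry.
Qed.

(** The 3 x 4 pencil that is Kronecker's block [L_3]: it has [s] on the main
    diagonal and [t] just above. *)
Definition support234 : seq letter :=
  [:: (0, 0, 0); (0, 1, 1); (0, 2, 2); (1, 0, 1); (1, 1, 2); (1, 2, 3)]%N.

Lemma tangent234 (F : fieldType) :
  tangent_full (@support F 2 3 4 support234).
Proof.
apply: tangent_nat => Y.
exists (fun _ _ => 0).
exists (fun p q => match p, q with
  | 0%N, 0%N => - Y 0 1 1 - Y 0 2 2 + Y 1 0 1 + Y 1 1 2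
  | 0%N, 1%N => Y 0 1 0 - Y 1 0 0
  | 0%N, 2%N => Y 0 2 0 - Y 1 1 0
  | 1%N, 0%N => - Y 0 1 2 - Y 0 2 3 + Y 1 0 2 + Y 1 1 3
  | 1%N, 1%N => - Y 0 2 2 + Y 1 1 2
  | 1%N, 2%N => Y 0 1 0 + Y 0 2 1 - Y 1 0 0 - Y 1 1 1
  | 2%N, 0%N => - Y 0 1 3 + Y 1 0 3
  | 2%N, 1%N => - Y 0 2 3 + Y 1 1 3
  | _, _ => 0 end).
exists (fun p q => match p, q with
  | 0%N, 0%N => Y 0 0 0 + Y 0 1 1 + Y 0 2 2 - Y 1 0 1 - Y 1 1 2
  | 0%N, 1%N => Y 0 0 1 + Y 0 1 2 + Y 0 2 3 - Y 1 0 2 - Y 1 1 3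
  | 0%N, 2%N => Y 0 0 2 + Y 0 1 3 - Y 1 0 3
  | 0%N, 3%N => Y 0 0 3
  | 1%N, 0%N => Y 1 0 0
  | 1%N, 1%N => Y 0 1 1 + Y 0 2 2 - Y 1 1 2
  | 1%N, 2%N => Y 0 1 2 + Y 0 2 3 - Y 1 1 3
  | 1%N, 3%N => Y 0 1 3
  | 2%N, 0%N => Y 1 1 0
  | 2%N, 1%N => - Y 0 1 0 + Y 1 0 0 + Y 1 1 1
  | 2%N, 2%N => Y 0 2 2
  | 2%N, 3%N => Y 0 2 3
  | 3%N, 0%N => Y 1 2 0
  | 3%N, 1%N => - Y 0 2 0 + Y 1 1 0 + Y 1 2 1
  | 3%N, 2%N => - Y 0 1 0 - Y 0 2 1 + Y 1 0 0 + Y 1 1 1 + Y 1 2 2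
  | 3%N, 3%N => Y 1 2 3
  | _, _ => 0 end).
by move=> [|[|?]] [|[|[|?]]] [|[|[|[|?]]]] // _ _ _; tangent_entry.
Qed.

(** * Weak stability *)

Lemma intr_neq0_char0 (F : fieldType) (z : int) :
  (forall k, k.+1%:R != 0 :> F) -> z != 0 -> z%:~R != 0 :> F.
Proof.
move=> char0; case: z => [[|k]|k] // _; first exact: char0.
by rewrite NegzE rmorphN /= oppr_eq0 char0.
Qed.

Lemma rectangles_weakly_stable (R : realType) n a1 m1 a2 m2 a3 m3 ps1 ps2 ps3
    (S : seq (nat * nat * nat)) :
    [/\ part_of n.+1 (nseq a1 m1), part_of n.+1 (nseq a2 m2)
      & part_of n.+1 (nseq a3 m3)] ->
    [/\ good_positions n.+1 ps1 a1 m1, good_positions n.+1 ps2 a2 m2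
      & good_positions n.+1 ps3 a3 m3] ->
    uniq S ->
    all (fun l => [&& l.1.1 < a1, l.1.2 < a2 & l.2 < a3]%N) S ->
    tangent_full (@support (complex R) a1 a2 a3 S) ->
    search S (letter_ok ps1 a1 m1 ps2 a2 m2 ps3 a3 m3)
      (letter_value ps1 a1 m1 ps2 a2 m2 ps3 a3 m3) n.+1 [::] != 0 ->
  weakly_stable R n.+1 (nseq a1 m1) (nseq a2 m2) (nseq a3 m3).
Proof.
move=> [part1 part2 part3] [good1 good2 good3] uS okS tangent nz.
split=> // k _; rewrite /scale_part !map_nseq.
have char0 i : i.+1%:R != 0 :> complex R by rewrite Num.Theory.pnatr_eq0.
apply: (kronecker_multiples char0 (position_bij good1) (position_bij good2)
  (position_bij good3) tangent).
by rewrite detform_search // intr_neq0_char0.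
Qed.

(** In the four lemmas below, any three arrangements whose invariant is nonzero
    at the tensor would do.  The invariants are multiples of Cayley's
    hyperdeterminant for 222, of the discriminant of the determinant of the
    pencil for 233, and their analogues of degree 6 and 12 in the other two
    cases. *)
Lemma weakly_stable222 (R : realType) :
  weakly_stable R 4 [:: 2; 2] [:: 2; 2] [:: 2; 2].
Proof.
apply: (@rectangles_weakly_stable R 3 2 2 2 2 2 2
  [:: 0; 1; 2; 3] [:: 0; 1; 2; 3] [:: 0; 2; 1; 3] support222)%N;
  [by []..| exact: tangent222 | by vm_compute].
Qed.

Lemma weakly_stable223 (R : realType) :
  weakly_stable R 6 [:: 3; 3] [:: 3; 3] [:: 2; 2; 2].
Proof.
apply: (@rectangles_weakly_stable R 5 2 3 2 3 3 2
  [:: 4; 5; 2; 3; 0; 1] [:: 2; 5; 0; 3; 1; 4] (iota 0 6) support223)%N;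
  [by []..| exact: tangent223 | by vm_compute].
Qed.

Lemma weakly_stable233 (R : realType) :
  weakly_stable R 12 [:: 6; 6] [:: 4; 4; 4] [:: 4; 4; 4].
Proof.
apply: (@rectangles_weakly_stable R 11 2 6 3 4 3 4
  [:: 3; 5; 2; 7; 8; 9; 1; 4; 0; 6; 10; 11]
  [:: 3; 8; 9; 0; 5; 7; 1; 6; 10; 2; 4; 11] (iota 0 12) support233)%N;
  [by []..| exact: tangent233 | by vm_compute].
Qed.

Lemma weakly_stable234 (R : realType) :
  weakly_stable R 12 [:: 6; 6] [:: 4; 4; 4] [:: 3; 3; 3; 3].
Proof.
apply: (@rectangles_weakly_stable R 11 2 6 3 4 4 3
  [:: 3; 10; 0; 1; 7; 8; 4; 6; 2; 5; 9; 11]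
  [:: 7; 9; 10; 0; 2; 4; 1; 5; 6; 3; 8; 11] (iota 0 12) support234)%N;
  [by []..| exact: tangent234 | by vm_compute].
Qed.

(** * Non-additivity *)

Section NotAdditive.

Local Open Scope nat_scope.

Lemma dvdn_nth0 d la i : all (dvdn d) la -> d %| nth 0 la i.
Proof.
move=> /allP dvd_la; have [lt_i|ge_i] := ltnP i (size la).
  exact/dvd_la/mem_nth.
by rewrite nth_default.
Qed.

(** The parts of a marginal are sums of parts of [la], so that a common divisor
    of the parts of one partition of an additive triple divides all parts. *)
Lemma additive_dvdn (R : realType) al be ga : additive_triple R al be ga ->
  exists2 la, la \in [:: al; be; ga]
    & forall d, all (dvdn d) la -> all (all (dvdn d)) [:: al; be; ga].
Proof.
case=> a [b [T [la [_ _ _ _ triple]]]]; exists la.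
  by rewrite (perm_mem triple) mem_head.
move=> d dvd_la; rewrite (perm_all _ triple) /= dvd_la /= andbT.
by apply/andP; split; apply/allP=> m; rewrite mem_filter => /andP[_ /mapP[i _ ->]];
  apply: dvdn_sum => k _; apply: dvdn_nth0.
Qed.

Lemma first_two_cells_aligned a b (T : 'M['I_(a * b)]_(a, b)) i0 j0 i1 j1 :
    standard_tableau T -> T i0 j0 = 0 :> nat -> T i1 j1 = 1 :> nat ->
  i0 = i1 \/ j0 = j1.
Proof.
move=> [T_inj _ T_col] T0 T1.
have [lt_i|lt_i|/val_inj] := ltngtP i0 i1; [right|exfalso|by left].
  have := T_col _ _ j1 lt_i; rewrite T1 ltnS leqn0 -T0 => /eqP/val_inj eqT.
  by have [] := T_inj (i0, j1) (i0, j0) eqT.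
by have := T_col _ _ j0 lt_i; rewrite T0.
Qed.

Lemma two_terms_leq_sum (I : finType) (f : I -> nat) i j : i != j ->
  f i + f j <= \sum_k f k.
Proof.
move=> neq_ij; rewrite (bigD1 i) //= leq_add2l (bigD1 j) ?leq_addr //.
by rewrite eq_sym.
Qed.

(** Divisibility says nothing here.  The two parts 2 of [la] sit in the two least
    cells of the tableau, which share a row or a column: the corresponding
    marginal has a part that is at least 4. *)
Lemma not_additive222 (R : realType) :
  ~ additive_triple R [:: 2; 2] [:: 2; 2] [:: 2; 2].
Proof.
case=> a [b [T [la [stdT _ _ sz_la triple]]]].
have eq22 s : s \in [:: la; row_marginal T la; col_marginal T la] -> s = [:: 2; 2].
  by rewrite -(perm_mem triple) !inE => /or3P[] /eqP.
have def_la : la = [:: 2; 2] by apply: eq22; rewrite mem_head.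
rewrite {la}def_la /= in sz_la triple eq22.
have row22 : row_marginal T [:: 2; 2] = [:: 2; 2].
  by apply: eq22; rewrite !inE eqxx !orbT.
have col22 : col_marginal T [:: 2; 2] = [:: 2; 2].
  by apply: eq22; rewrite !inE eqxx !orbT.
have [T_inj _ _] := stdT.
have T_bij : bijective (fun ij : 'I_a * 'I_b => T ij.1 ij.2).
  by apply: inj_card_bij; rewrite ?card_prod ?card_ord.
have cell k (lt_k : k < a * b) : exists i j, T i j = k :> nat.
  have [q _ qK] := T_bij.
  by exists (q (Ordinal lt_k)).1, (q (Ordinal lt_k)).2; rewrite [T _ _]qK.
have [i0 [j0 T0]] := cell 0 (ltnW sz_la); have [i1 [j1 T1]] := cell 1 sz_la.
case: (first_two_cells_aligned stdT T0 T1) => [eq_i|eq_j].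
  have neq_j : j0 != j1 by apply/eqP=> eq_j; rewrite eq_i eq_j T1 in T0.
  have := two_terms_leq_sum (fun j => nth 0 [:: 2; 2] (T i1 j)) neq_j.
  rewrite -{1}eq_i T0 T1 /= => le4.
  suff : \sum_(j < b) nth 0 [:: 2; 2] (T i1 j) \in [:: 2; 2].
    by rewrite !inE orbb => /eqP eq2; rewrite eq2 in le4.
  rewrite -[X in _ \in X]row22 mem_filter (leq_trans _ le4) //=.
  by apply/mapP; exists i1; rewrite ?mem_enum.
have neq_i : i0 != i1 by apply/eqP=> eq_i; rewrite eq_i eq_j T1 in T0.
have := two_terms_leq_sum (fun i => nth 0 [:: 2; 2] (T i j1)) neq_i.
rewrite -{1}eq_j T0 T1 /= => le4.
suff : \sum_(i < a) nth 0 [:: 2; 2] (T i j1) \in [:: 2; 2].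
  by rewrite !inE orbb => /eqP eq2; rewrite eq2 in le4.
rewrite -[X in _ \in X]col22 mem_filter (leq_trans _ le4) //=.
by apply/mapP; exists j1; rewrite ?mem_enum.
Qed.

Lemma not_additive223 (R : realType) :
  ~ additive_triple R [:: 3; 3] [:: 3; 3] [:: 2; 2; 2].
Proof.
case/additive_dvdn=> la; rewrite !inE => /or3P[] /eqP-> dvd_all.
- by have := dvd_all 3 isT.
- by have := dvd_all 3 isT.
- by have := dvd_all 2 isT.
Qed.

Lemma not_additive233 (R : realType) :
  ~ additive_triple R [:: 6; 6] [:: 4; 4; 4] [:: 4; 4; 4].
Proof.
case/additive_dvdn=> la; rewrite !inE => /or3P[] /eqP-> dvd_all.
- by have := dvd_all 6 isT.
- by have := dvd_all 4 isT.
- by have := dvd_all 4 isT.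
Qed.

Lemma not_additive234 (R : realType) :
  ~ additive_triple R [:: 6; 6] [:: 4; 4; 4] [:: 3; 3; 3; 3].
Proof.
case/additive_dvdn=> la; rewrite !inE => /or3P[] /eqP-> dvd_all.
- by have := dvd_all 6 isT.
- by have := dvd_all 4 isT.
- by have := dvd_all 3 isT.
Qed.

End NotAdditive.

Local Close Scope ring_scope.

Theorem proposition13 (R : realType) :
  (weakly_stable R 4 [:: 2; 2] [:: 2; 2] [:: 2; 2]
    /\ ~ additive_triple R [:: 2; 2] [:: 2; 2] [:: 2; 2])
  /\ (weakly_stable R 6 [:: 3; 3] [:: 3; 3] [:: 2; 2; 2]
    /\ ~ additive_triple R [:: 3; 3] [:: 3; 3] [:: 2; 2; 2])
  /\ (weakly_stable R 12 [:: 6; 6] [:: 4; 4; 4] [:: 4; 4; 4]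
    /\ ~ additive_triple R [:: 6; 6] [:: 4; 4; 4] [:: 4; 4; 4])
  /\ (weakly_stable R 12 [:: 6; 6] [:: 4; 4; 4] [:: 3; 3; 3; 3]
    /\ ~ additive_triple R [:: 6; 6] [:: 4; 4; 4] [:: 3; 3; 3; 3]).
Proof.
split; first by split; [apply: weakly_stable222 | apply: not_additive222].
split; first by split; [apply: weakly_stable223 | apply: not_additive223].
split; first by split; [apply: weakly_stable233 | apply: not_additive233].
by split; [apply: weakly_stable234 | apply: not_additive234].
Qed.
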